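(* Let $k\ge 1$ and let $\sigma=(1\,2\,\ldots\,k)\in S(k)$. (1) For every positive integer $d$, the coefficient of the linear monomial $R_d$ in Kerov's polynomial $K_k$ is the number of full cycles ($k$-cycles) $\tau\in S(k)$ such that $\tau^{-1}\sigma$ has exactly $d-1$ cycles. (2) Let $j,l$ be positive integers. The coefficient of $R_jR_l$ in $K_k$ is the number (if $j\ne l$), respectively half the number (if $j=l$), of pairs $(\tau,\varphi)$ satisfying the following conditions: - $\tau\in S(k)$ is a permutation with $|C(\tau)|=2$ and $\varphi$ is a bijection $C(\tau)\to\{1,2\}$; - $\tau^{-1}\sigma$ has $j+l-2$ cycles; - among the cycles of $\tau^{-1}\sigma$, at least $j$ have an element in common with $\varphi^{-1}(1)$ and at least $l$ have an element in common with $\varphi^{-1}(2)$.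
   Context: For $\tau\in S(k)$, $C(\tau)$ is the partition of the set $\{1,\dots,k\}$ into orbits of $\tau$ (the supports of the cycles of $\tau$, fixed points included); cycles are identified with their supports, and fixed points count as cycles. Here $(1\,2\,\ldots\,k)$ sends $1\mapsto2,\ 2\mapsto3,\dots,k\mapsto1$. Normalized character: for a Young diagram (partition) $\lambda\vdash n$ with $n\ge k$, $\Sigma_k(\lambda)=\frac{n(n-1)\cdots(n-k+1)\,\chi^\lambda(\sigma)}{\chi^\lambda(\mathrm{Id}_n)}$, where $\chi^\lambda$ is the character of the irreducible representation of the symmetric group $S(n)$ indexed by $\lambda$, and $\sigma=(1\,2\,\ldots\,k)\in S(k)\subset S(n)$ (elements of $S(k)$ fix $k+1,\dots,n$). Free cumulants: $R_i(\lambda)$, $i\ge 2$, are the free cumulants of the transition measure of $\lambda$. Explicitly, the content of the box in row $a$ and column $b$ is $b-a$; let $x_1,\dots,x_m$ be the contents of the boxes that can be added to $\lambda$ and $y_1,\dots,y_{m-1}$ the contents of the boxes that can be removed from $\lambda$ (so that a Young diagram is obtained). The transition measure is the probability measure on $\mathbb{R}$ with Cauchy transform $G_\lambda(z)=\prod_{i=1}^{m-1}(z-y_i)/\prod_{i=1}^{m}(z-x_i)$, and the $R_i(\lambda)$ are defined by the expansion of the compositional inverse $G_\lambda^{-1}(z)=\frac1z+\sum_{i\ge 1}R_i(\lambda)z^{i-1}$ (one has $R_1(\lambda)=0$). Kerov's polynomial: $K_k$ is the polynomial with integer coefficients in the variables $R_2,\dots,R_{k+1}$ (known to exist and to be unique)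 such that $\Sigma_k(\lambda)=K_k(R_2(\lambda),\dots,R_{k+1}(\lambda))$ for every Young diagram $\lambda$ of size at least $k$. The coefficient in $K_k$ of a monomial involving a variable not among $R_2,\dots,R_{k+1}$ is understood to be $0$. *)

(* Defs.v *)
From HB Require Import structures.
From mathcomp Require Import all_boot all_order all_fingroup all_algebra.
From mathcomp Require Import all_solvable all_field all_character.
From mathcomp Require Import fraction.
From mathcomp Require Import mpoly.
From mathcomp Require Import ring.

Set Implicit Arguments.
Unset Strict Implicit.
Unset Printing Implicit Defensive.

Import Order.TTheory GRing.Theory Num.Theory.
Local Open Scope ring_scope.

(* Young diagrams are lists of row lengths; rows, columns and the elements    *)
(* permuted by 'S_n are numbered from 0.                                      *)

Definition is_partition (n : nat) (la : seq nat) : bool :=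
  [&& sorted geq la, 0%N \notin la & sumn la == n].

(* Contents of the boxes that can be added: such a box sits at the end of a   *)
(* row a <= size la whose upper neighbour row, if any, is strictly longer.    *)
Definition addable_row (la : seq nat) (a : nat) : bool :=
  if a is b.+1 then (nth 0 la a < nth 0 la b)%N else true.

Definition addable_contents (la : seq nat) : seq rat :=
  [seq (nth 0%N la a)%:R - a%:R | a <- iota 0 (size la).+1 & addable_row la a].

(* A removable box is the last box, in column (nth 0 la a).-1, of a row a     *)
(* that is strictly longer than the next one.                                 *)
Definition removable_row (la : seq nat) (a : nat) : bool :=
  (nth 0 la a.+1 < nth 0 la a)%N.

Definition removable_contents (la : seq nat) : seq rat :=
  [seq (nth 0%N la a).-1%:R - a%:R | a <- iota 0 (size la) & removable_row la a].

Local Notation Qz := {fraction {poly rat}}.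
Local Notation "p %:F" := (tofrac p) : ring_scope.

(* The rational function G_la, evaluated at an element w of Q(z).             *)
Definition Cauchy_transform (la : seq nat) (w : Qz) : Qz :=
  \prod_(y <- removable_contents la) (w - y%:P%:F) /
  \prod_(x <- addable_contents la) (w - x%:P%:F).

(* f = O(z^r) at z = 0.                                                       *)
Definition vanishes_to_order (r : nat) (f : Qz) : Prop :=
  exists p q : {poly rat}, q.[0] != 0 /\ f = ('X^r * p)%:F / q%:F.

(* 1/z + R_1 + R_2 z + ... + R_N z^(N-1)                                      *)
Definition truncated_inverse (R : nat -> rat) (N : nat) : Qz :=
  ('X%:F)^-1 + \sum_(1 <= i < N.+1) (R i *: 'X^(i.-1))%:F.

(* G_la^{-1}(z) = 1/z + sum_(i >= 1) R_i z^(i-1) as formal Laurent series.    *)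
(* Since G_la(w) = 1/w + O(1/w^2) at infinity, changing its argument          *)
(* 1/z + ... by O(z^N) changes the value by O(z^(N+2)); the expansion thus    *)
(* amounts to G_la(truncation at order N) = z + O(z^(N+2)) for every N.       *)
Definition inverse_expansion (la : seq nat) (R : nat -> rat) : Prop :=
  forall N, vanishes_to_order N.+2
    (Cauchy_transform la (truncated_inverse R N) - 'X%:F).

Section FreeCumulants.

Variable la : seq nat.

Let xs := addable_contents la.
Let ys := removable_contents la.

Let size_xs : size xs = (size ys).+1.
Proof.
rewrite /xs /ys /addable_contents /removable_contents !size_map /=.
congr _.+1; rewrite -[1%N]/(1 + 0)%N iotaDl filter_map size_map.
by congr size; apply: eq_filter.
Qed.

Let prodC (s : seq rat) (C : {poly rat}) := \prod_(x <- s) (C - x *: 'X).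

Let defect (C : {poly rat}) := prodC ys C - prodC xs C.

Let C_ (R : nat -> rat) N : {poly rat} := 1 + \sum_(1 <= i < N.+1) R i *: 'X^i.

Let C_S R N : C_ R N.+1 = C_ R N + R N.+1 *: 'X^(N.+1).
Proof. by rewrite /C_ big_nat_recr //= addrA. Qed.

Let horner_C R N : (C_ R N).[0] = 1.
Proof.
elim: N => [|N IH]; first by rewrite /C_ big_geq // addr0 hornerC.
by rewrite C_S hornerD IH hornerZ hornerXn expr0n mulr0 addr0.
Qed.

Let horner_prodC s C : C.[0] = 1 -> (prodC s C).[0] = 1.
Proof.
move=> C0; rewrite /prodC horner_prod big1 // => y _.
by rewrite hornerD hornerN hornerZ hornerX C0 mulr0 subr0.
Qed.

Let unitX (P : {poly rat}) : P.[0] = 1 -> exists p, P = 1 + 'X * p.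
Proof.
move=> P0; have: root (P - 1) 0.
  by rewrite rootE hornerD hornerN hornerC P0 subrr.
move/factor_theorem => [p]; rewrite polyC0 subr0 => /eqP.
by rewrite subr_eq => /eqP ->; exists p; rewrite addrC mulrC.
Qed.

Let prodCD s (C : {poly rat}) c N : C.[0] = 1 ->
  exists q, prodC s (C + c *: 'X^(N.+1)) =
    prodC s C + 'X^(N.+1) * ((size s)%:R * c%:P + 'X * q).
Proof.
move=> C0; elim: s => [|x s [q IH]].
  by exists 0; rewrite /prodC !big_nil mul0r mulr0 addr0 mulr0 addr0.
have [p1 Dp1] := unitX (horner_prodC s C0); have [p2 Dp2] := unitX C0.
have cons C' : prodC (x :: s) C' = (C' - x%:P * 'X) * prodC s C'.
  by rewrite /prodC big_cons mul_polyC.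
rewrite !cons IH /= -natr1 Dp1 Dp2 -!mul_polyC exprS.
set m := (size s)%:R : {poly rat}; set b := c%:P; set d := x%:P.
exists (b * p1 + (p2 - d) * (m * b + 'X * q) + q
        + b * 'X^N * (m * b + 'X * q)).
ring.
Qed.

Let defectD R N r : exists q, defect (C_ R N + r *: 'X^(N.+1)) =
  defect (C_ R N) - r *: 'X^(N.+1) + 'X^(N.+2) * q.
Proof.
have [q1 e1] := prodCD ys r N (horner_C R N).
have [q2 e2] := prodCD xs r N (horner_C R N).
exists (q1 - q2); rewrite /defect e1 e2 size_xs -natr1 -mul_polyC.
rewrite [in RHS](exprS _ N.+1).
move: (prodC ys _) (prodC xs _) ('X^(N.+1)) (_%:R) (r%:P) => P Q Y m b; ring.
Qed.

Let fracE (F : fieldType) (P Q X Y : F) : Q != 0 -> X != 0 -> Y != 0 ->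
  P / Y / (Q / (X * Y)) - X = X * (P - Q) / Q.
Proof. by move=> Q0 X0 Y0; field; rewrite ?Q0 ?X0 ?Y0. Qed.

Let inverse_expansionE R :
  inverse_expansion la R <-> forall N, 'X^(N.+1) %| defect (C_ R N).
Proof.
have Fneq0 (p : {poly rat}) : p.[0] != 0 -> p%:F != 0.
  by rewrite tofrac_eq0; apply: contraNneq => ->; rewrite horner0.
have Xn0 : ('X : {poly rat})%:F != 0 by rewrite tofrac_eq0 polyX_eq0.
have argE N : truncated_inverse R N = (C_ R N)%:F / 'X%:F.
  rewrite /truncated_inverse /C_ rmorphD rmorph1 mulrDl div1r; congr (_ + _).
  rewrite rmorph_sum mulr_suml; apply: eq_big_nat => -[|i] // _.
  by rewrite exprSr scalerAl rmorphM mulfK.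
have prodE s N : \prod_(x <- s) (truncated_inverse R N - x%:P%:F) =
    (prodC s (C_ R N))%:F / 'X%:F ^+ size s.
  elim: s => [|x s IH]; first by rewrite !big_nil /prodC big_nil rmorph1 invr1 mulr1.
  rewrite big_cons IH argE /prodC big_cons rmorphM exprS -mulf_div.
  by congr (_ * _); rewrite rmorphB -mul_polyC rmorphM mulrBl mulfK.
have GE N : Cauchy_transform la (truncated_inverse R N) - 'X%:F =
    ('X * defect (C_ R N))%:F / (prodC xs (C_ R N))%:F.
  rewrite /Cauchy_transform -/xs -/ys !prodE size_xs exprS.
  have /Fneq0 Pn0 : (prodC xs (C_ R N)).[0] != 0.
    by rewrite horner_prodC ?oner_neq0.
  rewrite rmorphM /defect rmorphB.
  exact: (@fracE _ _ _ _ _ Pn0 Xn0 (expf_neq0 (size ys) Xn0)).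
split=> H N.
  have [p [q [q0 e]]] := H N; have P0 := horner_prodC xs (horner_C R N).
  have /Fneq0 Pn0 : (prodC xs (C_ R N)).[0] != 0 by rewrite P0 oner_neq0.
  have e1 : 'X * defect (C_ R N) * q = 'X^(N.+2) * p * prodC xs (C_ R N).
    apply/eqP; rewrite -tofrac_eq (tofracM _ q) (tofracM _ (prodC _ _)).
    by rewrite -(eqr_div _ _ Pn0 (Fneq0 _ q0)) -GE e.
  have e2 : defect (C_ R N) * q = 'X^(N.+1) * p * prodC xs (C_ R N).
    by apply: (mulfI (negbT (polyX_eq0 _))); rewrite mulrA e1 exprS -!mulrA.
  have /Gauss_dvdpl <- : coprimep 'X^(N.+1) q.
    by rewrite coprimep_expl // -['X]subr0 -polyC0 coprimep_sym coprimep_XsubC.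
  by rewrite e2 -mulrA dvdp_mulr.
have /dvdpP[p Dp] := H N; exists p, (prodC xs (C_ R N)).
by rewrite horner_prodC ?oner_neq0 // GE Dp [p * _]mulrC mulrA -exprS.
Qed.

Let dvdpXn_coef (p : {poly rat}) N : 'X^N %| p ->
  ('X^(N.+1) %| p) = (p`_N == 0).
Proof.
move=> /dvdpP[q ->]; rewrite exprS dvdp_mul2r ?monic_neq0 ?monicXn //.
by rewrite coefMXn ltnn subnn -['X]subr0 -polyC0 dvdp_XsubCl rootE horner_coef0.
Qed.

Lemma inverse_expansion_exists : {R : nat -> rat | inverse_expansion la R}.
Proof.
pose fix C N : {poly rat} := if N is M.+1 then
  C M + (defect (C M))`_N *: 'X^N else 1.
pose R N := if N is M.+1 then (defect (C M))`_N else 0.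
exists R; apply/inverse_expansionE => N.
have CE M : C_ R M = C M by elim: M => [|M IH]; rewrite ?C_S ?IH // /C_ big_geq ?addr0.
elim: N => [|N IH].
  rewrite CE expr1 -['X]subr0 -polyC0 dvdp_XsubCl rootE.
  by rewrite /defect hornerD hornerN !horner_prodC ?hornerC ?subrr.
have [q Dq] := defectD R N (R N.+1); move: Dq; rewrite -C_S => ->.
have dv : ('X^(N.+1) : {poly rat}) %| defect (C_ R N) - R N.+1 *: 'X^(N.+1).
  by rewrite dvdp_sub // -mul_polyC dvdp_mull.
rewrite dvdp_addl ?dvdp_mulIl // dvdpXn_coef //.
by rewrite coefB coefZ coefXn eqxx mulr1 /= -CE subrr.
Qed.

Lemma inverse_expansion_unique R R' :
  inverse_expansion la R -> inverse_expansion la R' ->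
  forall i, (0 < i)%N -> R i = R' i.
Proof.
move=> /inverse_expansionE HR /inverse_expansionE HR'.
have coefE S : (forall N, 'X^(N.+1) %| defect (C_ S N)) ->
    forall N, S N.+1 = (defect (C_ S N))`_N.+1.
  move=> HS N; have [q Dq] := defectD S N (S N.+1).
  have := HS N.+1; rewrite C_S Dq dvdp_addl ?dvdp_mulIl // dvdpXn_coef.
    by rewrite coefB coefZ coefXn eqxx mulr1 subr_eq0 => /eqP.
  by rewrite dvdp_sub // -mul_polyC dvdp_mull.
have CE N : C_ R N = C_ R' N.
  elim: N => [|N IH]; first by rewrite /C_ !big_geq.
  by rewrite !C_S (coefE _ HR) (coefE _ HR') IH.
by case=> // i _; rewrite (coefE _ HR) (coefE _ HR') CE.
Qed.

End FreeCumulants.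

(* R_i(la) for i >= 1; the value at i = 0 is irrelevant.                      *)
Definition free_cumulant (la : seq nat) : nat -> rat :=
  sval (inverse_expansion_exists la).

(* The diagram is filled with 0, 1, ..., n-1 row by row.                      *)
Definition row_group (n : nat) (la : seq nat) : {set 'S_n} :=
  [set s : 'S_n | [forall i, reshape_index la (s i) == reshape_index la i]].

Definition column_group (n : nat) (la : seq nat) : {set 'S_n} :=
  [set s : 'S_n | [forall i, reshape_offset la (s i) == reshape_offset la i]].

Local Notation SG n := [set: 'S_n]%G.

Definition Young_symmetrizer (n : nat) (la : seq nat) : 'rV[algC]_#|SG n| :=
  gring_row (\sum_(p in row_group n la) \sum_(q in column_group n la)
    (-1) ^+ q *: regular_repr algC (SG n) (p * q)%g).

(* chi^la is afforded by the Specht module, the cyclic submodule of the       *)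
(* regular representation generated by the Young symmetrizer.                 *)
Definition irr_character (n : nat) (la : seq nat) : 'CF(SG n) :=
  cfRepr (submod_repr (cyclic_mx_module (regular_repr algC (SG n))
                                        (Young_symmetrizer n la))).

(* minn k n only serves to make the definition total: it is k when k <= n.    *)
Definition long_cycle_fun (k n : nat) (i : 'I_n) : 'I_n :=
  if (i < k)%N then insubd i (i.+1 %% minn k n)%N else i.

Fact long_cycle_inj (k n : nat) : injective (@long_cycle_fun k n).
Proof.
move=> i j; have lt_m (l : 'I_n) : (l < k -> l < minn k n)%N.
  by rewrite leq_min ltn_ord andbT.
have valE (l : 'I_n) : (l < k)%N ->
    val (long_cycle_fun k l) = (l.+1 %% minn k n)%N.
  move=> lk; rewrite /long_cycle_fun lk val_insubd.
  by rewrite (leq_trans (ltn_pmod _ _) (geq_minr k n)) // (leq_trans _ (lt_m _ lk)).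
have fixE (l : 'I_n) : (l < k)%N = false -> long_cycle_fun k l = l.
  by rewrite /long_cycle_fun => ->.
have ltE (l : 'I_n) : (long_cycle_fun k l < k)%N = (l < k)%N.
  case lk: (l < k)%N; last by rewrite fixE.
  rewrite valE // (leq_trans (ltn_pmod _ _) (geq_minl k n)) //.
  by rewrite (leq_trans _ (lt_m _ lk)).
move=> e; have eqk : (i < k)%N = (j < k)%N by rewrite -ltE e ltE.
case jk: (j < k)%N eqk => ik; last by rewrite -(fixE i) // e fixE.
have /eqP := congr1 val e; rewrite (valE i) // (valE j) //.
rewrite -(addn1 i) -(addn1 j) eqn_modDr !modn_small ?lt_m //.
by move=> /eqP /val_inj.
Qed.

(* The cycle (1 2 ... k) as an element of S(n), for k <= n.                   *)
Definition long_cycle (k n : nat) : 'S_n := perm (@long_cycle_inj k n).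

Definition normalized_character (k n : nat) (la : seq nat) : algC :=
  (n ^_ k)%:R * irr_character n la (long_cycle k n) / irr_character n la 1%g.

(* The variable 'X_i of {mpoly int[k]}, for i < k, stands for R_(i+2).        *)
Definition is_Kerov_polynomial (k : nat) (K : {mpoly int[k]}) : Prop :=
  forall (n : nat) (la : seq nat), is_partition n la -> (k <= n)%N ->
    normalized_character k n la =
      ratr (map_mpoly intr K).@[fun i : 'I_k => free_cumulant la i.+2].

(* The coefficient in K of the product of the R_d for d in ds.                *)
Definition Kerov_coef (k : nat) (K : {mpoly int[k]}) (ds : seq nat) : int :=
  if all (fun d => 2 <= d <= k.+1)%N ds
  then K@_[multinom count_mem (i : nat).+2 ds | i < k] else 0.

(* Permutations are composed from right to left in tau^-1 sigma; for %g, the  *)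
(* leftmost factor acts first.                                                *)
Definition quotient_perm (k : nat) (t : 'S_k) : 'S_k :=
  (long_cycle k k * t^-1)%g.

Definition full_cycles (k d : nat) : {set 'S_k} :=
  [set t : 'S_k | (#|porbits t| == 1%N) && (#|porbits (quotient_perm t)| == d.-1)].

Definition cycles_meeting (k : nat) (s : 'S_k) (A : {set 'I_k}) :
  {set {set 'I_k}} := [set c in porbits s | c :&: A != set0].

(* A bijection phi : C(tau) -> {1, 2} is represented by its inverse psi, with *)
(* 1 and 2 read as ord0 and ord_max in 'I_2.                                  *)
Definition labelled_pairs (k j l : nat) :
  {set 'S_k * {ffun 'I_2 -> {set 'I_k}}} :=
  [set tp : 'S_k * {ffun 'I_2 -> {set 'I_k}} | let: (t, psi) := tp in
    [&& #|porbits t| == 2%N,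
        injectiveb psi,
        psi @: [set: 'I_2] == porbits t,
        #|porbits (quotient_perm t)| == (j + l - 2)%N,
        (j <= #|cycles_meeting (quotient_perm t) (psi ord0)|)%N &
        (l <= #|cycles_meeting (quotient_perm t) (psi ord_max)|)%N]].

(* Main.v *)
(* With c the Young symmetrizer of la, c^2 = kappa c, so the trace on the      *)
(* Specht module is read off from left multiplication by c, and               *)
(* chi(g)/chi(1) is the average of the coefficients of c at the conjugates of *)
(* g^-1.  Expanding c gives Sigma_k as a signed count of maps from {1..k} to  *)
(* the boxes of la with t-invariant rows and (t^-1 sigma)-invariant columns;  *)
(* maps that are not injective cancel, so all maps may be counted.  On a      *)
(* diagram made of p1 rows of length q1 above p2 rows of length q2 this is a  *)
(* polynomial in p1, p2, q1, q2 (Stanley's formula), and so are the free      *)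
(* cumulants, which modulo p1^2 and p2^2 are                                  *)
(*   R_n = p1 q1^(n-1) + p2 q2^(n-1)                                          *)
(*         - (n-1) p1 p2 sum_(0 < i < n-1) q1^(n-2-i) q2^i.                   *)
(* The coefficients of p1 and of p1 p2 in Sigma_k = K(R_2, R_3, ...) thus     *)
(* involve only the linear and quadratic terms of K.  If e_b counts the       *)
(* labelled t with two cycles for which t^-1 sigma has m = j + l - 2 cycles,  *)
(* b of them meeting the second cycle of t, then the coefficient of R_j R_l   *)
(* (doubled if j = l) is e_m - e_(l-1).  As sigma is transitive, the sets of  *)
(* pairs excluded by the two inequalities are disjoint, and e_b = e_(m-b) for *)
(* 0 < b < m turns the count of the remaining pairs into e_m - e_(l-1).       *)

Require Import Defs.
From HB Require Import structures.
From mathcomp Require Import all_boot all_order all_fingroup all_algebra.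
From mathcomp Require Import all_field all_character.
From mathcomp Require Import fraction qpoly.
From mathcomp Require Import mpoly.
From mathcomp Require Import ring zify.

Set Implicit Arguments.
Unset Strict Implicit.
Unset Printing Implicit Defensive.

Import Order.TTheory GRing.Theory Num.Theory.
Local Open Scope ring_scope.

(** * The Young symmetrizer and the character of the Specht module *)

(** Kerov's polynomial is tested only on diagrams formed by p1 rows of length q1 above p2 rows of
    length q2. Both sides of Sigma_k = K(R_2, R_3, ...) are then polynomials in p1, p2, q1, q2, and
    since the identity holds for enough natural numbers it holds formally
    ([Kerov_identity_generic]). On the character side, [normalized_characterE] and
    [normalized_character_two_rectangles] give Sigma_k as a sum over t in S(k) and over colourings
    of the cycles of t. A cycle of t contributes p1 or p2, so the coefficients of p1 and p1 p2
    concern the t with one and with two cycles; by [odd_quotient_perm] their signs are + and -. On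
    the cumulant side every R_i vanishes at p1 = p2 = 0, so the same two coefficients see only the
    linear and quadratic terms of K. [first_order_cumulantP] gives R_i modulo p1^2 and p2^2, and
    [mmap_first_order] expands K there; [Kerov_coefficients] records the resulting two identities in
    q1, q2. The first identity is part (1). In the second, the linear terms of K contribute to q1^a
    q2^b, for b > 0, an amount that depends on a + b only, while the quadratic terms are absent for
    a = 0. Subtracting the case a = 0 isolates a quadratic coefficient as a difference of two counts
    ([Kerov_quadratic_coefficient]). Since the coefficient of R_j R_l does not depend on the order
    of j and l, these counts have a symmetry ([bicoloured_count_sym]), which together with the
    transitivity of sigma turns the difference into the number of pairs of part (2)
    ([card_labelled_pairsE]). *)

Section Tableau.

Variables (n : nat) (la : seq nat).
Hypothesis sum_la : sumn la = n.

Definition box_row (i : 'I_n) : nat := reshape_index la i.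
Definition box_col (i : 'I_n) : nat := reshape_offset la i.

Lemma box_inj (i j : 'I_n) : box_row i = box_row j -> box_col i = box_col j -> i = j.
Proof.
rewrite /box_row /box_col => er ec; apply: val_inj.
by rewrite /= -(reshape_indexK la i) -(reshape_indexK la j) er ec.
Qed.

Lemma box_row_lt i : (box_row i < size la)%N.
Proof. by rewrite reshape_indexP // sum_la. Qed.

Lemma box_col_lt i : (box_col i < nth 0 la (box_row i))%N.
Proof. by rewrite reshape_offsetP // sum_la. Qed.

Lemma box_exists r c : (c < nth 0 la r)%N ->
  {i : 'I_n | box_row i = r & box_col i = c}.
Proof.
move=> lt_c; have lt_n : (flatten_index la r c < n)%N by rewrite -sum_la flatten_indexP.
by exists (Ordinal lt_n); rewrite ?/box_row ?/box_col ?flatten_indexKl ?flatten_indexKr.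
Qed.

Lemma row_groupP (s : 'S_n) :
  reflect (forall i, box_row (s i) = box_row i) (s \in row_group n la).
Proof. by rewrite inE; apply: (iffP forallP) => H i; apply/eqP/H. Qed.

Lemma column_groupP (s : 'S_n) :
  reflect (forall i, box_col (s i) = box_col i) (s \in column_group n la).
Proof. by rewrite inE; apply: (iffP forallP) => H i; apply/eqP/H. Qed.

Lemma row_column_trivial (s : 'S_n) :
  s \in row_group n la -> s \in column_group n la -> s = 1%g.
Proof.
move=> /row_groupP sr /column_groupP sc.
by apply/permP => i; rewrite perm1; apply: box_inj; rewrite ?sr ?sc.
Qed.

Lemma row_group_set : group_set (row_group n la).
Proof.
apply/group_setP; split=> [|s t /row_groupP Hs /row_groupP Ht]; apply/row_groupP => i.
  by rewrite perm1.
by rewrite permM Ht Hs.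
Qed.

Lemma column_group_set : group_set (column_group n la).
Proof.
apply/group_setP; split=> [|s t /column_groupP Hs /column_groupP Ht]; apply/column_groupP => i.
  by rewrite perm1.
by rewrite permM Ht Hs.
Qed.

Definition row_Group := Group row_group_set.
Definition column_Group := Group column_group_set.

(* Double counting of the boxes that z sends to the first j columns: a row    *)
(* contains at most as many of them as it has boxes in these columns.         *)
Lemma injective_box_col_lt (z : 'S_n) :
  (forall a b, box_row a = box_row b -> box_col (z a) = box_col (z b) -> a = b) ->
  forall a, (box_col (z a) < nth 0 la (box_row a))%N.
Proof.
move=> zinj a0; set j := nth 0%N la (box_row a0).
pose A (i : 'I_(size la)) := [set a | (box_row a == i) && (box_col (z a) < j)%N].
pose B (i : 'I_(size la)) := [set a | (box_row a == i) && (box_col a < j)%N].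
have sumE (P : pred 'I_n) :
    (\sum_(i < size la) #|[set a | (box_row a == i) && P a]| = #|[set a | P a]|)%N.
  rewrite -[RHS]sum1_card (partition_big (fun a => Ordinal (box_row_lt a)) predT) //=.
  by apply: eq_bigr => i _; rewrite -sum1_card; apply: eq_bigl => a; rewrite !inE andbC.
have leAB i : (#|A i| <= #|B i|)%N.
  have [le_j|lt_j] := leqP (nth 0%N la i) j.
    apply: subset_leq_card; apply/subsetP => a; rewrite !inE => /andP[/eqP ai _].
    by rewrite ai eqxx /= (leq_trans _ le_j) // -ai box_col_lt.
  apply: (@leq_trans j).
    have [j0|j_gt0] := posnP j.
      by rewrite [leqRHS]j0 leqn0 cards_eq0; apply/eqP/setP => a; rewrite !inE j0 ltn0 andbF.
    rewrite -[leqRHS](prednK j_gt0) -[leqRHS]card_ord.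
    rewrite -(@card_in_imset _ _ (fun a => inord (box_col (z a)) : 'I_j.-1.+1)).
      by rewrite max_card.
    move=> a b; rewrite !inE => /andP[/eqP ai za] /andP[/eqP bi zb] /(congr1 val).
    by rewrite /= !inordK ?prednK // => /zinj; apply; rewrite ai bi.
  pose f (c : 'I_j) := s2val (box_exists (ltn_trans (ltn_ord c) lt_j)).
  have fr c : box_row (f c) = i by rewrite /f; case: box_exists.
  have fc c : box_col (f c) = c by rewrite /f; case: box_exists.
  have finj : injective f by move=> c d /(congr1 box_col); rewrite !fc; apply: val_inj.
  rewrite -{1}[j]card_ord -(card_imset _ finj); apply: subset_leq_card.
  by apply/subsetP => _ /imsetP[c _ ->]; rewrite inE fr fc eqxx /=.
have eqS : (\sum_(i < size la) #|A i| = \sum_(i < size la) #|B i|)%N.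
  rewrite !sumE -(card_imset [set a | (box_col a < j)%N] (@perm_inj _ z^-1%g)).
  apply: eq_card => a; rewrite inE; apply/idP/imsetP => [lt|[b]].
    by exists (z a); rewrite ?inE ?permK.
  by rewrite inE => lt ->; rewrite permKV.
have eqAB : (#|A (Ordinal (box_row_lt a0))| == #|B (Ordinal (box_row_lt a0))|)%N.
  have := leqif_sum (fun i (_ : predT i) => leqif_eq (leAB i)).
  by case=> _; rewrite eqS eqxx => /esym/forall_inP; apply.
have sub : A (Ordinal (box_row_lt a0)) \subset B (Ordinal (box_row_lt a0)).
  apply/subsetP => a; rewrite !inE => /andP[/eqP /= e _].
  by rewrite /= e eqxx /= /j -[in X in nth _ _ X]e box_col_lt.
have /eqP eAB : A (Ordinal (box_row_lt a0)) == B (Ordinal (box_row_lt a0)).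
  by rewrite eqEcard sub (eqP eqAB) leqnn.
have : a0 \in B (Ordinal (box_row_lt a0)) by rewrite inE eqxx box_col_lt.
by rewrite -eAB inE => /andP[].
Qed.

(** Move each box a within its row to the column of z a: [injective_box_col_lt] says that this place
    exists, and the hypothesis makes the move a permutation p. What remains, p^-1 z, preserves
    columns. *)
Lemma mem_row_mul_column (z : 'S_n) :
  (forall a b, box_row a = box_row b -> box_col (z a) = box_col (z b) -> a = b) ->
  z \in (row_group n la * column_group n la)%g.
Proof.
move=> zinj; have lt_z := injective_box_col_lt zinj.
pose p a := s2val (box_exists (lt_z a)).
have pr a : box_row (p a) = box_row a by rewrite /p; case: box_exists.
have pc a : box_col (p a) = box_col (z a) by rewrite /p; case: box_exists.
have pinj : injective p.
  by move=> a b eab; apply: zinj; [rewrite -(pr a) eab pr | rewrite -(pc a) eab pc].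
apply/imset2P; exists (perm pinj) ((perm pinj)^-1 * z)%g; last by rewrite mulKVg.
  by apply/row_groupP => a; rewrite permE.
apply/column_groupP => a; rewrite -[a in RHS](permKV (perm pinj)) permM.
by rewrite [in RHS]permE pc.
Qed.

Definition Young_coef (z : 'S_n) : algC :=
  \sum_(p in row_group n la) \sum_(q in column_group n la)
     (-1) ^+ q * ((p * q)%g == z)%:R.

Lemma Young_coef_mul p q : p \in row_group n la -> q \in column_group n la ->
  Young_coef (p * q)%g = (-1) ^+ q.
Proof.
move=> pP qQ; rewrite /Young_coef (bigD1 p) //= (bigD1 q) //= eqxx mulr1.
rewrite big1 ?addr0 => [|q' /andP[_ /negPf nq]]; last by rewrite (inj_eq (mulgI p)) nq mulr0.
rewrite big1 ?addr0 // => p' /andP[p'P np]; rewrite big1 // => q' q'Q.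
case: eqP => [e|]; rewrite ?mulr0 //; case/eqP: np.
have: (p^-1 * p')%g = 1%g.
  apply: row_column_trivial.
    by rewrite (@groupM _ row_Group) ?(@groupV _ row_Group).
  have -> : (p^-1 * p' = q * q'^-1)%g.
    by rewrite -[q in RHS](mulKg p) -e !mulgA mulgK.
  by rewrite (@groupM _ column_Group) ?(@groupV _ column_Group).
by move=> e1; rewrite -(mulKVg p p') e1 mulg1.
Qed.

Lemma Young_coef1 : Young_coef 1%g = 1.
Proof.
rewrite -{1}[1%g](mulg1 1%g) Young_coef_mul ?odd_perm1 //.
  exact: (@group1 _ row_Group).
exact: (@group1 _ column_Group).
Qed.

(** Off the products p q the function f must vanish: by [mem_row_mul_column] such a z sends two
    boxes a, b of one row to one column, and the transposition (a b) can be read as a row or as a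
    column permutation, with opposite effects on f z. *)
Lemma Young_alternating (f : 'S_n -> algC) :
  (forall p z, p \in row_group n la -> f (p * z)%g = f z) ->
  (forall q z, q \in column_group n la -> f (z * q)%g = (-1) ^+ q * f z) ->
  forall z, f z = f 1%g * Young_coef z.
Proof.
move=> fP fQ z.
have [/imset2P[p q pP qQ ->]|nPQ] := boolP (z \in (row_group n la * column_group n la)%g).
  rewrite Young_coef_mul // fP // -{1}[q]mul1g fQ // mulrC; congr (_ * _).
have -> : Young_coef z = 0.
  rewrite /Young_coef big1 // => p pP; rewrite big1 // => q qQ.
  by case: eqP => [e|]; rewrite ?mulr0 //; case/negP: nPQ; rewrite -e mem_mulg.
rewrite mulr0; pose bad a b := [&& box_row a == box_row b,
   box_col (z a) == box_col (z b) & a != b].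
have [[a b] /= |nbad] := pickP (fun ab : 'I_n * 'I_n => bad ab.1 ab.2); last first.
  case/negP: nPQ; apply: mem_row_mul_column => a b er ec.
  by have := nbad (a, b); rewrite /bad /= er ec !eqxx => /negbFE/eqP.
case/and3P => /eqP er /eqP ec nab.
have tP : tperm a b \in row_group n la.
  by apply/row_groupP => i; case: tpermP => [->|->|].
have tQ : tperm (z a) (z b) \in column_group n la.
  by apply/column_groupP => i; case: tpermP => [->|->|].
(* Here (a b) z = z (z a, z b), so f z is its own opposite. *)
have := fP _ z tP; rewrite -[(_ * z)%g]mul1g -{1}(mulgV z) -mulgA -/(conjg _ _) tpermJ.
rewrite fQ // odd_tperm (inj_eq perm_inj) nab expr1 mulN1r => /eqP.
by rewrite eqr_oppLR -addr_eq0 -mulr2n mulrn_eq0 /= => /eqP.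
Qed.

End Tableau.

(** * Character values as averages of coefficients of the Young symmetrizer *)

Section SpechtTrace.

Variables (n : nat) (la : seq nat).
Hypothesis sum_la : sumn la = n.

Local Notation SG := [set: 'S_n]%G.
Local Notation rG := (regular_repr algC SG).
Local Notation u := (Young_symmetrizer n la).
Local Notation c := (Young_coef la).
Local Notation ix := (@gring_index _ SG).

Lemma regular_coef (v : 'rV[algC]_#|SG|) x z :
  (v *m rG x) 0 (ix z) = v 0 (ix (z * x^-1)%g).
Proof.
rewrite mxE (bigD1 (ix (z * x^-1)%g)) //= mxE mxE !eqxx /=.
rewrite gring_indexK ?inE // mulgKV eqxx mulr1 big1 ?addr0 // => i ni.
rewrite !mxE eqxx /=; case: eqP => [e|]; rewrite ?mulr0 //; case/eqP: ni.
have := congr1 enum_val e; rewrite !gring_indexK ?inE // => ->.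
by rewrite mulgK gring_valK.
Qed.

Lemma Young_symmetrizer_coef z : u 0 (ix z) = c z.
Proof.
rewrite /Young_symmetrizer linear_sum summxE; apply: eq_bigr => p _.
rewrite linear_sum summxE; apply: eq_bigr => q _.
rewrite linearZ /gring_row /= !mxE gring_indexK ?inE // mul1g eqxx /=.
congr (_ * _%:R); rewrite eq_sym; congr nat_of_bool.
by rewrite -(inj_eq (can_inj (gring_valK (G := SG)))) !gring_indexK ?inE.
Qed.

Lemma Young_coef_row p z : p \in row_group n la -> c (p * z)%g = c z.
Proof.
move=> pP; rewrite /Young_coef (reindex_inj (mulgI p)) /=; apply: eq_big => [p'|p' p'P].
  exact: (@groupMl _ (row_Group n la)).
by apply: eq_bigr => q _; rewrite -mulgA (inj_eq (mulgI p)).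
Qed.

Lemma gring_mx_Young : gring_mx rG u =
  \sum_(p in row_group n la) \sum_(q in column_group n la) (-1) ^+ q *: rG (p * q)%g.
Proof.
rewrite -gring_opE /Young_symmetrizer linear_sum; apply: eq_bigr => p _.
rewrite linear_sum; apply: eq_bigr => q _.
rewrite linearZ /=; congr (_ *: _).
by apply: (gring_opG rG); rewrite inE.
Qed.

(** The coefficients of c^2 are still row-invariant on the left and column-alternating on the right,
    so [Young_alternating] makes them proportional to those of c. *)
Lemma Young_quasi_idempotent : {kappa | u *m gring_mx rG u = kappa *: u}.
Proof.
set v := u *m _; exists (v 0 (ix 1%g)); apply/rowP => j.
rewrite -(gring_valK j) [RHS]mxE Young_symmetrizer_coef; move: (enum_val j) => z {j}.
have vE y : v 0 (ix y) = \sum_(p in row_group n la) \sum_(q in column_group n la)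
    (-1) ^+ q * c (y * (p * q)^-1)%g.
  rewrite /v gring_mx_Young mulmx_sumr summxE; apply: eq_bigr => p _.
  rewrite mulmx_sumr summxE; apply: eq_bigr => q _.
  by rewrite -scalemxAr mxE regular_coef Young_symmetrizer_coef.
apply: (Young_alternating sum_la (f := fun y => v 0 (ix y))) => p y pP; rewrite !vE.
  by apply: eq_bigr => p' _; apply: eq_bigr => q _; rewrite -mulgA Young_coef_row.
rewrite mulr_sumr; apply: eq_bigr => p' _; rewrite mulr_sumr.
rewrite (reindex_inj (mulIg p)); apply: eq_big => [q|q _] /=.
  exact: (@groupMr _ (column_Group n la)).
rewrite odd_permM signr_addb -mulrA mulrCA; congr (_ * (_ * c _)).
by rewrite !invMg !mulgA mulgK.
Qed.

(** Left multiplication by the Young symmetrizer; group elements act on row vectors by right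
    multiplication. *)
Definition Young_mulmx : 'M[algC]_#|SG| := \matrix_i (u *m rG (enum_val i)).

Lemma Young_mulmxE (w : 'rV_#|SG|) : w *m Young_mulmx = u *m gring_mx rG w.
Proof.
rewrite mulmx_sum_row /gring_mx /= [w *m enveloping_algebra_mx _]mulmx_sum_row linear_sum.
rewrite mulmx_sumr; apply: eq_bigr => i _.
by rewrite linearZ /= rowK rowK mxvecK scalemxAr.
Qed.

Lemma trace_Young_mulmx g :
  \tr (Young_mulmx *m rG g) = \sum_(x : 'S_n) c (x * g^-1 * x^-1)%g.
Proof.
rewrite /mxtrace (reindex_onto enum_val ix); last by move=> x _; rewrite gring_indexK ?inE.
apply: eq_big => [i|i _]; first by rewrite gring_valK eqxx.
have -> : (Young_mulmx *m rG g) i i = (row i (Young_mulmx *m rG g)) 0 (ix (enum_val i)).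
  by rewrite gring_valK [RHS]mxE.
by rewrite row_mul rowK !regular_coef Young_symmetrizer_coef.
Qed.

(** Left multiplication by c maps the group algebra into the Specht module and acts on that module
    as the scalar kappa. Factoring it through the module and using tr(XY) = tr(YX) leaves kappa
    times the trace of g there. *)
Lemma trace_Young_mulmx_Specht : {kappa : algC | forall g,
  \tr (Young_mulmx *m rG g) = kappa * irr_character n la g}.
Proof.
have [kappa idem] := Young_quasi_idempotent; exists kappa => g.
set U := cyclic_mx rG u; set modU := cyclic_mx_module rG u.
have sLU : (Young_mulmx <= U)%MS.
  apply/row_subP => i; rewrite rowK; apply/cyclic_mxP; exists (rG (enum_val i)) => //.
  by rewrite envelop_mx_id ?inE.
set A := in_submod U Young_mulmx; set W := val_submod (U := U) 1%:M.
have AW : A *m W = Young_mulmx by rewrite -val_submodE in_submodK.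
have WL : W *m Young_mulmx = kappa *: W.
  apply/row_matrixP => i; rewrite row_mul linearZ /=.
  have /cyclic_mxP[B EB ->] : (row i W <= U)%MS.
    by rewrite (submx_trans (row_sub _ _)) ?val_submodP.
  case/submxP: EB => b /(congr1 vec_mx); rewrite mxvecK => ->.
  rewrite -[vec_mx _]/(gring_mx rG b) Young_mulmxE.
  by rewrite gring_mxA mulmxA idem -scalemxAl.
have WA : W *m A = kappa%:M.
  apply: (@val_submod_inj _ _ U); rewrite !(val_submodE (_ *m _)) -/W -mulmxA AW WL.
  by rewrite [RHS]val_submodE -/W mul_scalar_mx.
have Wg : W *m rG g = submod_mx modU g *m W.
  by rewrite -val_submodJ ?inE // mul1mx -val_submodE.
rewrite -AW -mulmxA Wg mulmxA mxtrace_mulC mulmxA WA mul_scalar_mx mxtraceZ.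
by rewrite /irr_character cfunE inE mulr1n.
Qed.

(** At g = 1 the trace is n!, as c has coefficient 1 at the identity; hence kappa chi(1) = n! and
    kappa is nonzero. *)
Lemma irr_characterE g :
  irr_character n la g / irr_character n la 1%g =
  (\sum_(x : 'S_n) c (x * g^-1 * x^-1)%g) / n`!%:R.
Proof.
have [kappa trE] := trace_Young_mulmx_Specht.
have := trE 1%g; rewrite trace_Young_mulmx.
rewrite (eq_bigr (fun=> 1)) => [|x _]; last by rewrite invg1 mulg1 mulgV Young_coef1.
rewrite sumr_const cardT -cardE card_Sn => e.
have nz : n`!%:R != 0 :> algC by rewrite pnatr_eq0 -lt0n fact_gt0.
have := nz; rewrite e mulf_eq0 negb_or => /andP[k0 _].
by rewrite -trace_Young_mulmx trE -mulf_div divff // mul1r.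
Qed.

End SpechtTrace.

(** * Stanley's character formula *)

Section ExtendPerm.

Variables (k n : nat).
Hypothesis le_kn : (k <= n)%N.

Local Notation wd := (widen_ord le_kn).

Lemma widen_ord_split (i : 'I_n) : {j : 'I_k | i = wd j} + {(k <= i)%N}.
Proof.
have [le|lt] := leqP k i; first by right.
by left; exists (Ordinal lt); apply: val_inj.
Qed.

Definition ext_perm_fun (t : 'S_k) (i : 'I_n) : 'I_n :=
  oapp (fun j => wd (t j)) i (insub (val i)).

Lemma ext_perm_fun_widen t j : ext_perm_fun t (wd j) = wd (t j).
Proof. by rewrite /ext_perm_fun /= valK. Qed.

Lemma ext_perm_fun_ge t (i : 'I_n) : (k <= i)%N -> ext_perm_fun t i = i.
Proof. by move=> le; rewrite /ext_perm_fun insubF // ltnNge le. Qed.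

Lemma widen_ord_inj : injective wd.
Proof. by move=> i j /(congr1 val) /= /val_inj. Qed.

Lemma ext_perm_inj t : injective (ext_perm_fun t).
Proof.
move=> i i'; have [[j ->]|le] := widen_ord_split i;
  have [[j' ->]|le'] := widen_ord_split i'; rewrite ?ext_perm_fun_widen.
- by move/widen_ord_inj/perm_inj => ->.
- by rewrite ext_perm_fun_ge // => e; move: le'; rewrite -e /= leqNgt ltn_ord.
- by rewrite ext_perm_fun_ge // => e; move: le; rewrite e /= leqNgt ltn_ord.
by rewrite !ext_perm_fun_ge.
Qed.

Definition ext_perm t : 'S_n := perm (@ext_perm_inj t).

Lemma ext_perm_widen t j : ext_perm t (wd j) = wd (t j).
Proof. by rewrite permE ext_perm_fun_widen. Qed.

Lemma ext_perm_ge t (i : 'I_n) : (k <= i)%N -> ext_perm t i = i.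
Proof. by move=> le; rewrite permE ext_perm_fun_ge. Qed.

Lemma ext_permM s t : ext_perm (s * t)%g = (ext_perm s * ext_perm t)%g.
Proof.
apply/permP => i; rewrite permM; have [[j ->]|le] := widen_ord_split i.
  by rewrite !ext_perm_widen permM.
by rewrite !ext_perm_ge.
Qed.

Lemma ext_perm1 : ext_perm 1%g = 1%g.
Proof. by apply: (mulgI (ext_perm 1%g)); rewrite -ext_permM !mulg1. Qed.

Lemma ext_permV t : ext_perm t^-1%g = (ext_perm t)^-1%g.
Proof. by apply/eqP; rewrite eq_mulgV1 invgK -ext_permM mulVg ext_perm1. Qed.

Lemma ext_perm_can_inj : injective ext_perm.
Proof.
move=> s t e; apply/permP => j; apply: widen_ord_inj.
by rewrite -!ext_perm_widen e.
Qed.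

Lemma odd_ext_perm t : odd_perm (ext_perm t) = odd_perm t.
Proof.
have [ts -> _] := prod_tpermP t.
elim: ts => [|[a b] ts IH]; first by rewrite !big_nil ext_perm1 !odd_perm1.
rewrite !big_cons ext_permM !odd_permM IH; congr (_ (+) _).
have -> : ext_perm (tperm a b) = tperm (wd a) (wd b).
  apply/permP => i; have [[j ->]|le] := widen_ord_split i.
    rewrite ext_perm_widen; case: tpermP => [->|->|]; rewrite ?tpermL ?tpermR //.
    by move=> /eqP na /eqP nb; rewrite tpermD // eq_sym (inj_eq widen_ord_inj).
  rewrite ext_perm_ge // tpermD //; apply: contraTneq le => <-; by rewrite -ltnNge /= ltn_ord.
by rewrite !odd_tperm (inj_eq widen_ord_inj).
Qed.

Lemma ext_perm_surj (s : 'S_n) : (forall i : 'I_n, (k <= i)%N -> s i = i) ->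
  exists t, s = ext_perm t.
Proof.
move=> sfix; have lt_s (j : 'I_k) : (s (wd j) < k)%N.
  rewrite ltnNge; apply/negP => le; have /perm_inj e := sfix _ le.
  by move: le; rewrite e leqNgt /= ltn_ord.
pose f j := Ordinal (lt_s j).
have wdf j : wd (f j) = s (wd j) by apply: val_inj.
have finj : injective f.
  by move=> i j /(congr1 wd); rewrite !wdf => /perm_inj/widen_ord_inj.
exists (perm finj); apply/permP => i; have [[j ->]|le] := widen_ord_split i.
  by rewrite ext_perm_widen permE wdf.
by rewrite ext_perm_ge // sfix.
Qed.

Lemma ext_long_cycle : ext_perm (long_cycle k k) = long_cycle k n.
Proof.
have lcE (m : nat) (i : 'I_m) : (k <= m)%N -> (i < k)%N ->
    val (long_cycle k m i) = (i.+1 %% k)%N.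
  move=> le lt; have k0 : (0 < k)%N by apply: leq_trans lt.
  rewrite permE /long_cycle_fun lt val_insubd (minn_idPl le).
  by rewrite (leq_trans (ltn_pmod _ k0) le).
apply/permP => i; have [[j ->]|le] := widen_ord_split i.
  rewrite ext_perm_widen; apply: val_inj.
  exact: etrans (lcE k j (leqnn k) (ltn_ord j)) (esym (lcE n (wd j) le_kn (ltn_ord j))).
by rewrite ext_perm_ge // permE /long_cycle_fun ltnNge le.
Qed.

Definition restrict_perm (x : 'S_n) : {ffun 'I_k -> 'I_n} := [ffun j => x (wd j)].

Lemma restrict_perm_surj (f : {ffun 'I_k -> 'I_n}) : injective f ->
  exists x, restrict_perm x = f.
Proof.
(* The values of f followed by all other points list every point once, which is a permutation
   extending f. *)
move=> finj; pose s := codom f ++ enum (predC (mem (codom f))).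
have us : uniq s.
  rewrite cat_uniq enum_uniq map_inj_uniq // enum_uniq andbT /=.
  by apply/hasPn => i; rewrite mem_enum.
have mems : s =i enum 'I_n.
  by move=> i; rewrite mem_enum mem_cat mem_enum inE orbN.
have /tuple_permP[x ex] : perm_eq s (ord_tuple n).
  by rewrite uniq_perm // val_ord_tuple enum_uniq.
exists x; apply/ffunP => j; rewrite ffunE.
have := congr1 (fun s => nth (x (wd j)) s j) ex.
rewrite -[X in nth _ (tval (mktuple _)) X]/(val (wd j)) -tnth_nth tnth_mktuple tnth_ord_tuple => <-.
by rewrite nth_cat size_codom card_ord ltn_ord (nth_map j) ?nth_ord_enum // size_enum_ord.
Qed.

(* All fibres of the restriction map over injections have the same size.      *)
Lemma sum_restrict_perm (F : {ffun 'I_k -> 'I_n} -> algC) :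
  (n ^_ k)%:R * (\sum_(x : 'S_n) F (restrict_perm x)) / n`!%:R =
  \sum_(f : {ffun 'I_k -> 'I_n} | injectiveb f) F f.
Proof.
pose s := #|[set x | restrict_perm x == restrict_perm 1%g]|.
have fibre (f : {ffun 'I_k -> 'I_n}) : injectiveb f -> #|[set x | restrict_perm x == f]| = s.
  move=> /injectiveP/restrict_perm_surj[y <-].
  rewrite /s -(card_imset [set x | restrict_perm x == restrict_perm 1%g] (mulIg y)).
  apply: eq_card => x.
  rewrite inE; apply/eqP/imsetP => [e|[z]].
    exists (x * y^-1)%g; rewrite ?mulgKV // inE; apply/eqP/ffunP => j.
    by have /ffunP/(_ j) := e; rewrite !ffunE permM perm1 => ->; rewrite permK.
  rewrite inE => /eqP e ->; apply/ffunP => j.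
  by have /ffunP/(_ j) := e; rewrite !ffunE permM perm1 => ->.
have inj_res x : injectiveb (restrict_perm x).
  by apply/injectiveP => i j; rewrite !ffunE => /perm_inj/widen_ord_inj.
have sumE (F' : {ffun 'I_k -> 'I_n} -> algC) : \sum_(x : 'S_n) F' (restrict_perm x) =
    s%:R * \sum_(f : {ffun 'I_k -> 'I_n} | injectiveb f) F' f.
  rewrite (partition_big restrict_perm (fun f : {ffun 'I_k -> 'I_n} => injectiveb f)) //= mulr_sumr.
  apply: eq_bigr => f fi; rewrite -(fibre f fi) (eq_bigr (fun=> F' f)) => [|x /eqP -> //].
  by rewrite sumr_const -[LHS]mulr_natl; congr (_%:R * _); apply: eq_card => x; rewrite inE.
have nz : n`!%:R != 0 :> algC by rewrite pnatr_eq0 -lt0n fact_gt0.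
have := sumE (fun=> 1); rewrite !sumr_const cardT -cardE card_Sn.
have -> : #|[pred f : {ffun 'I_k -> 'I_n} | injectiveb f]| = (n ^_ k)%N.
  have := card_inj_ffuns 'I_k 'I_n; rewrite !card_ord => <-.
  by apply: eq_card => f; rewrite !inE.
move=> e; rewrite sumE; apply: (canLR (mulfK nz)).
by rewrite e; ring.
Qed.
End ExtendPerm.

Definition invariant (m : nat) (T : eqType) (h : 'I_m -> T) (s : 'S_m) : bool :=
  [forall a, h (s a) == h a].

Lemma invariantP m (T : eqType) (h : 'I_m -> T) (s : 'S_m) :
  reflect (forall a, h (s a) = h a) (invariant h s).
Proof. by apply: (iffP forallP) => H a; apply/eqP/H. Qed.

(** * The normalized character as a signed count of maps to the boxes *)

Section StanleyFormula.

Variables (n : nat) (la : seq nat).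
Hypothesis sum_la : sumn la = n.

Local Notation row f := (fun a => box_row la (f a)).
Local Notation col f := (fun a => box_col la (f a)).

Lemma mem_row_groupJ (x t : 'S_n) : ((t ^ x)%g \in row_group n la) = invariant (row x) t.
Proof.
apply/row_groupP/invariantP => H a; first by have := H (x a); rewrite permJ.
by rewrite -[a](permKV x) permJ H.
Qed.

Lemma mem_column_groupJ (x t : 'S_n) :
  ((t ^ x)%g \in column_group n la) = invariant (col x) t.
Proof.
apply/column_groupP/invariantP => H a; first by have := H (x a); rewrite permJ.
by rewrite -[a](permKV x) permJ H.
Qed.

(** A factorization of x^-1 g^-1 x as p q is determined by p; writing p as the conjugate of t^-1 by
    x makes q the conjugate of (g t^-1)^-1. *)
Lemma Young_coef_conj (g x : 'S_n) : Young_coef la (x^-1 * g^-1 * x)%g =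
  \sum_(t : 'S_n | invariant (row x) t && invariant (col x) (g * t^-1)%g)
     (-1) ^+ (g * t^-1)%g.
Proof.
have -> : Young_coef la (x^-1 * g^-1 * x)%g =
    \sum_(p : 'S_n | (p \in row_group n la) &&
            ((p^-1 * (x^-1 * g^-1 * x))%g \in column_group n la))
       (-1) ^+ (p^-1 * (x^-1 * g^-1 * x))%g.
  set z := (x^-1 * _ * x)%g; rewrite /Young_coef big_mkcondr; apply: eq_bigr => p _.
  case: ifP => pz; last first.
    rewrite big1 // => q qQ; case: eqP => [e|]; rewrite ?mulr0 //.
    by rewrite -e mulKg qQ in pz.
  rewrite (bigD1 (p^-1 * z)%g) //= mulKVg eqxx mulr1 big1 ?addr0 // => q /andP[_ /eqP nq].
  by case: eqP => [e|]; rewrite ?mulr0 //; case: nq; rewrite -e mulKg.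
have hinj : injective (fun t : 'S_n => (t^-1 ^ x)%g).
  by move=> s t /conjg_inj/invg_inj.
rewrite (reindex_inj hinj).
have zE t : ((t^-1 ^ x)^-1 * (x^-1 * g^-1 * x) = ((g * t^-1)^-1 ^ x))%g.
  by rewrite -[(x^-1 * _ * x)%g]mulgA -/(conjg g^-1 x) -conjVg invgK -conjMg invMg invgK.
apply: eq_big => [t|t _] /=; last first.
  by rewrite zE odd_permJ odd_permV.
rewrite zE conjVg (@groupV _ (row_Group n la)) mem_row_groupJ; congr (_ && _).
by rewrite conjVg (@groupV _ (column_Group n la)) mem_column_groupJ.
Qed.

Variable k : nat.

Definition signed_factorizations (f : 'I_k -> 'I_n) : algC :=
  \sum_(t : 'S_k | invariant (row f) t && invariant (col f) (quotient_perm t))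
     (-1) ^+ quotient_perm t.

(* If f a = f b, then multiplying t by the transposition (a b) on the         *)
(* appropriate side is a sign-reversing involution of the summands.           *)
Lemma signed_factorizations_noninj f : ~ injective f -> signed_factorizations f = 0.
Proof.
move=> ninj; have [a [b [nab fab]]] : exists a, exists b, a != b /\ f a = f b.
  have [[a b] /= /andP[nab /eqP fab]|inj] := pickP (fun ab => (ab.1 != ab.2) && (f ab.1 == f ab.2)).
    by exists a, b.
  by case: ninj => a b e; have := inj (a, b); rewrite /= e eqxx andbT => /negbFE/eqP.
have ft i : f (tperm a b i) = f i by case: tpermP => [->|->|].
have qE t : quotient_perm (tperm a b * t)%g = (quotient_perm t * tperm a b)%g.
  by rewrite /quotient_perm invMg tpermV mulgA.
set S := signed_factorizations f; have : S = - S.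
  rewrite {1}/S /signed_factorizations (reindex_inj (mulgI (tperm a b))) -sumrN.
  apply: eq_big => [t|t _]; last first.
    by rewrite qE odd_permM odd_tperm nab addbT signrN.
  rewrite qE; congr (_ && _).
    apply/invariantP/invariantP => H i.
      by have := H (tperm a b i); cbv beta; rewrite permM tpermK ft.
    by have := H (tperm a b i); cbv beta; rewrite permM ft.
  by apply/invariantP/invariantP => H i; have := H i; cbv beta; rewrite (permM (quotient_perm t)) ft.
by move/eqP; rewrite -addr_eq0 -mulr2n mulrn_eq0 /= => /eqP.
Qed.

Hypothesis le_kn : (k <= n)%N.

Local Notation wd := (widen_ord le_kn).

(** Only t in S(k) contribute: a point i >= k is fixed by the long cycle, so invariance of rows and
    of columns puts x i and x (t^-1 i) in the same row and column, and t fixes i. *)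
Lemma Young_coef_long_cycle (x : 'S_n) :
  Young_coef la (x^-1 * (long_cycle k n)^-1 * x)%g =
  signed_factorizations (restrict_perm le_kn x).
Proof.
rewrite Young_coef_conj.
have qE t : (long_cycle k n * (ext_perm le_kn t)^-1)%g = ext_perm le_kn (quotient_perm t).
  by rewrite /quotient_perm ext_permM ext_permV ext_long_cycle.
have invE (T : eqType) (h : 'I_n -> T) (t : 'S_k) :
    invariant (h \o x) (ext_perm le_kn t) = invariant (h \o restrict_perm le_kn x) t.
  apply/invariantP/invariantP => H i /=.
    by have := H (wd i); rewrite /= !ffunE ext_perm_widen.
  have [[j ->]|le] := widen_ord_split le_kn i; last by rewrite ext_perm_ge.
  by rewrite ext_perm_widen; have := H j; rewrite /= !ffunE.
pose P (t : 'S_n) := invariant (row x) t && invariant (col x) (long_cycle k n * t^-1)%g.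
have PE t : P (ext_perm le_kn t) = invariant (row (restrict_perm le_kn x)) t &&
    invariant (col (restrict_perm le_kn x)) (quotient_perm t).
  by rewrite /P qE; congr (_ && _); apply: invE.
have Pext t : P t -> exists s, t = ext_perm le_kn s.
  case/andP => /invariantP rt /invariantP ct; apply: ext_perm_surj => i le_i.
  have fix_i : (t^-1)%g i = i.
    apply: (@perm_inj _ x); apply: (box_inj (la := la)).
      by have := rt ((t^-1)%g i); rewrite permKV.
    have := ct i; rewrite permM; have -> : long_cycle k n i = i; last by [].
    by rewrite permE /long_cycle_fun ltnNge le_i.
  by rewrite -{1}fix_i permKV.
transitivity (\sum_(t in [set ext_perm le_kn s | s : 'S_k & P (ext_perm le_kn s)])
    (-1) ^+ (long_cycle k n * t^-1)%g : algC).
  apply: eq_bigl => t; apply/idP/imsetP => [Pt|[s]]; last by rewrite inE => Ps ->.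
  by have [s es] := Pext t Pt; exists s; rewrite // inE -es.
rewrite big_imset /=; last by move=> s t _ _; apply: ext_perm_can_inj.
apply: eq_big => [t|t _]; first by rewrite inE PE.
by rewrite qE odd_ext_perm.
Qed.

(** The falling factorial turns the average over S(n) into a sum over injections of {1..k}; the
    other maps contribute 0 and are added so that rows and columns can be chosen freely. *)
Lemma normalized_characterE : normalized_character k n la =
  \sum_(f : {ffun 'I_k -> 'I_n}) signed_factorizations f.
Proof.
rewrite /normalized_character -mulrA irr_characterE // mulrA.
rewrite (reindex_inj invg_inj) /=.
under eq_bigr => x _ do rewrite invgK Young_coef_long_cycle.
rewrite (sum_restrict_perm le_kn (fun f : {ffun 'I_k -> 'I_n} => signed_factorizations f)).
rewrite [RHS](bigID (fun f : {ffun 'I_k -> 'I_n} => injectiveb f)) /=.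
rewrite [X in _ + X]big1 ?addr0 // => f /injectiveP.
exact: signed_factorizations_noninj.
Qed.

End StanleyFormula.

(** * Counting the maps into a union of two rectangles *)

Lemma invariant_porbit m (T : eqType) (h : 'I_m -> T) (s : 'S_m) (a b : 'I_m) :
  invariant h s -> b \in porbit s a -> h b = h a.
Proof.
move=> /invariantP hs /porbitP[i ->]; elim: i => [|i IH]; first by rewrite perm1.
by rewrite expgSr permM hs.
Qed.

(** An invariant function is an independent choice, for each cycle, of one value allowed at all
    points of the cycle. *)
Lemma card_invariant k N (s : 'S_k) (D : 'I_k -> pred 'I_N) : (0 < N)%N ->
  #|[set c : {ffun 'I_k -> 'I_N} | invariant c s && [forall a, D a (c a)]]| =
  (\prod_(o in porbits s) #|[set x | [forall a in o, D a x]]|)%N.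
Proof.
move=> N_gt0; have memP a : porbit s a \in porbits s by apply: imset_f.
pose y0 := Ordinal N_gt0.
pose F (o : {set 'I_k}) : {pred 'I_N} := [set x | [forall a in o, D a x]].
have -> : (\prod_(o in porbits s) #|[set x | [forall a in o, D a x]]| =
    #|pfamily y0 (mem (porbits s)) F|)%N.
  by rewrite card_pfamily foldrE big_image.
pose G (g : {ffun {set 'I_k} -> 'I_N}) := [ffun a => g (porbit s a)].
rewrite -(card_in_imset (f := G)) => [|g g'].
  apply: eq_card => c; rewrite inE; apply/andP/imsetP => [[ci /forallP cD]|[g /pfamilyP[_ gF] ->]].
    (* The value [y0] off the cycles is the support condition of [pfamily]. *)
    exists [ffun o : {set 'I_k} => if o \in porbits s then
              odflt y0 (omap c [pick b in o]) else y0].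
      apply/pfamilyP; split=> [|o].
        by apply/supportP => o no; rewrite ffunE (negPf no).
      move=> oP; rewrite ffunE /= oP; case/imsetP: (oP) => a _ ->{oP}.
      case: pickP => [b ba|/(_ a)]; last by rewrite porbit_id.
      rewrite inE; apply/forall_inP => a' a'a.
      by rewrite /= (invariant_porbit ci ba) -(invariant_porbit ci a'a).
    apply/ffunP => a; rewrite !ffunE memP.
    case: pickP => [b ba|/(_ a)]; last by rewrite porbit_id.
    by rewrite /= (invariant_porbit ci ba).
  split.
    apply/invariantP => a; rewrite !ffunE.
    by congr (g _); have := porbit_perm s 1 a; rewrite expg1.
  apply/forallP => a; rewrite ffunE.
  have := gF (porbit s a) (memP a); rewrite inE => /forall_inP; apply.
  exact: porbit_id.
move=> /pfamilyP[/supportP gs _] /pfamilyP[/supportP gs' _] /ffunP e.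
apply/ffunP => o; have [/imsetP[a _ ->]|no] := boolP (o \in porbits s).
  by have := e a; rewrite !ffunE.
by rewrite gs ?gs'.
Qed.

Definition orbit_weight (A : comNzRingType) k (s : 'S_k) (phi : 'I_k -> bool) (x y : A) : A :=
  \prod_(o in porbits s) (if [exists a in o, phi a] then y else x).

(** Here [phi] marks the points sent to the lower rectangle. It is stated over any ring so that p1,
    p2, q1, q2 can be both numbers and indeterminates. *)
Definition Stanley_sum (A : comNzRingType) k (p1 p2 q1 q2 : A) : A :=
  \sum_(t : 'S_k) \sum_(phi : {ffun 'I_k -> bool} | invariant phi t)
    (-1) ^+ quotient_perm t * orbit_weight t phi p1 p2 *
    orbit_weight (quotient_perm t) phi q1 q2.

Lemma rmorph_Stanley_sum (A B : comNzRingType) (g : {rmorphism A -> B}) k p1 p2 q1 q2 :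
  g (Stanley_sum k p1 p2 q1 q2) = Stanley_sum k (g p1) (g p2) (g q1) (g q2).
Proof.
have wE (s : 'S_k) (phi : 'I_k -> bool) (x y : A) :
    g (orbit_weight s phi x y) = orbit_weight s phi (g x) (g y).
  by rewrite rmorph_prod; apply: eq_bigr => o _; case: ifP.
rewrite rmorph_sum; apply: eq_bigr => t _; rewrite rmorph_sum; apply: eq_bigr => phi _.
by rewrite !rmorphM rmorph_sign !wE.
Qed.

Definition two_rectangles (p1 p2 q1 q2 : nat) : seq nat := nseq p1 q1 ++ nseq p2 q2.

Section TwoRectangles.

Variables p1 p2 q1 q2 k : nat.
Hypotheses (p1_gt0 : (0 < p1)%N) (q1_gt0 : (0 < q1)%N) (le_q : (q2 <= q1)%N).

Local Notation la := (two_rectangles p1 p2 q1 q2).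
Local Notation n := (p1 * q1 + p2 * q2)%N.

Lemma size_two_rectangles : size la = (p1 + p2)%N.
Proof. by rewrite size_cat !size_nseq. Qed.

Lemma sumn_two_rectangles : sumn la = n.
Proof. by rewrite sumn_cat !sumn_nseq ![(_ * p1)%N]mulnC ![(_ * p2)%N]mulnC. Qed.

Lemma nth_two_rectangles r :
  nth 0%N la r = if (r < p1)%N then q1 else if (r < p1 + p2)%N then q2 else 0%N.
Proof.
rewrite nth_cat size_nseq; case: ltnP => [lt|le]; rewrite nth_nseq ?lt //.
by rewrite -(ltn_add2l p1) subnKC.
Qed.

Let sum_la := sumn_two_rectangles.

Lemma row_two_rectangles_lt (i : 'I_n) : (box_row la i < p1 + p2)%N.
Proof. by have := box_row_lt sum_la i; rewrite size_two_rectangles. Qed.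

Lemma col_two_rectangles_lt (i : 'I_n) : (box_col la i < q1)%N.
Proof.
have := box_col_lt sum_la i; rewrite nth_two_rectangles row_two_rectangles_lt.
by case: ifP => // _ lt; apply: leq_trans lt le_q.
Qed.

Definition rect_row (i : 'I_n) := Ordinal (row_two_rectangles_lt i).
Definition rect_col (i : 'I_n) := Ordinal (col_two_rectangles_lt i).

Lemma rect_inj i j : rect_row i = rect_row j -> rect_col i = rect_col j -> i = j.
Proof. by move=> [er] [ec]; apply: box_inj er ec. Qed.

Lemma rect_exists (r : 'I_(p1 + p2)) (c : 'I_q1) : (p1 <= r)%N ==> (c < q2)%N ->
  {i | rect_row i = r & rect_col i = c}.
Proof.
move=> rc; have lt_c : (c < nth 0 la r)%N.
  rewrite nth_two_rectangles (ltn_ord r); have [_|le] := ltnP r p1; first exact: ltn_ord.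
  by rewrite le in rc.
by have [i ir ic] := box_exists sum_la lt_c; exists i; apply: val_inj.
Qed.

Lemma rect_row_col i : (p1 <= rect_row i)%N ==> (rect_col i < q2)%N.
Proof.
have := box_col_lt sum_la i; rewrite nth_two_rectangles row_two_rectangles_lt.
by case: (ltnP (box_row la i) p1).
Qed.

(** Sort the maps by the set [phi] of points sent to the lower rectangle. Rows are constant on a
    cycle of t, with p1 or p2 choices according to its colour; columns are constant on a cycle of s,
    which has only the q2 short columns available once one of its points is marked. *)
Lemma card_rect_functions (t s : 'S_k) :
  #|[set f : {ffun 'I_k -> 'I_n} |
      invariant (fun a => box_row la (f a)) t && invariant (fun a => box_col la (f a)) s]| =
  (\sum_(phi : {ffun 'I_k -> bool} | invariant phi t)
    (\prod_(o in porbits t) (if [exists a in o, phi a] then p2 else p1) *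
     \prod_(o in porbits s) (if [exists a in o, phi a] then q2 else q1)))%N.
Proof.
pose low (f : {ffun 'I_k -> 'I_n}) := [ffun a => p1 <= rect_row (f a)]%N.
pose X := [set f : {ffun 'I_k -> 'I_n} |
      invariant (fun a => box_row la (f a)) t && invariant (fun a => box_col la (f a)) s].
rewrite -/X -sum1_card (partition_big low (fun phi => invariant phi t)) => [|f] /=; last first.
  rewrite inE => /andP[/invariantP ft _]; apply/invariantP => a.
  by rewrite !ffunE /= ft.
apply: eq_bigr => phi phit.
pose R := [set r : {ffun 'I_k -> 'I_(p1 + p2)} | invariant r t &&
  [forall a, (p1 <= r a)%N == phi a]].
pose C := [set c : {ffun 'I_k -> 'I_q1} | invariant c s &&
  [forall a, phi a ==> (c a < q2)%N]].
have -> : (\prod_(o in porbits t) (if [exists a in o, phi a] then p2 else p1) = #|R|)%N.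
  rewrite (card_invariant t (fun a r => (p1 <= r)%N == phi a)) ?addn_gt0 ?p1_gt0 //.
  apply: eq_bigr => o /imsetP[a _ ->].
  have phiE b : b \in porbit t a -> phi b = phi a by apply: invariant_porbit.
  have -> : [exists b in porbit t a, phi b] = phi a.
    apply/exists_inP/idP => [[b /phiE <-] //|pa]; exists a; rewrite ?porbit_id //.
  transitivity #|[set x : 'I_(p1 + p2) | (p1 <= x)%N == phi a]|; last first.
    apply: eq_card => x; rewrite !inE; apply/idP/forall_inP => [/eqP e b /phiE ->|H].
      by rewrite e.
    exact: H (porbit_id t a).
  case: (phi a).
    rewrite -[LHS]card_ord -(card_imset _ (@rshift_inj p1 p2)); apply: eq_card => x.
    rewrite inE eqb_id; apply/imsetP/idP => [[y _ ->] /=|le]; first by rewrite leq_addr.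
    case: (split_ordP x) le => y ->; last by exists y.
    by rewrite /= leqNgt ltn_ord.
  rewrite -[LHS]card_ord -(card_imset _ (@lshift_inj p1 p2)); apply: eq_card => x.
  rewrite inE eqbF_neg -ltnNge; apply/imsetP/idP => [[y _ ->] //=|lt].
  case: (split_ordP x) lt => y ->; first by exists y.
  by [].
have -> : (\prod_(o in porbits s) (if [exists a in o, phi a] then q2 else q1) = #|C|)%N.
  rewrite (card_invariant s (fun a c => phi a ==> (c < q2)%N)) //.
  apply: eq_bigr => o _; case: ifP => [/exists_inP[a ao pa]|/exists_inP nphi].
    rewrite -[LHS]card_ord -(card_imset _ (widen_ord_inj (le_kn := le_q))).
    apply: eq_card => x; rewrite inE; apply/imsetP/forall_inP => [[y _ ->] b _|/(_ a ao)].
      by apply/implyP => _ /=.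
    by rewrite pa => lt; exists (Ordinal lt) => //; apply: val_inj.
  rewrite -[LHS]card_ord; apply: eq_card => x; rewrite !inE; apply/esym/forall_inP => a ao.
  by apply/implyP => pa; case: nphi; exists a.
rewrite -cardsX sum1_card.
pose psi (f : {ffun 'I_k -> 'I_n}) := ([ffun a => rect_row (f a)], [ffun a => rect_col (f a)]).
have psi_inj : injective psi.
  move=> f f' [/ffunP er /ffunP ec]; apply/ffunP => a.
  by apply: rect_inj; [have := er a | have := ec a]; rewrite !ffunE.
rewrite -(card_imset _ psi_inj); apply: eq_card => -[r c]; rewrite !inE /=.
apply/imsetP/idP => [[f]|].
  rewrite unfold_in /= inE => /andP[/andP[/invariantP rt /invariantP cs] /eqP lowf] [-> ->].
  apply/andP; split; apply/andP; split.
  - by apply/invariantP => a; rewrite !ffunE; apply: val_inj; apply: rt.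
  - by apply/forallP => a; rewrite -lowf !ffunE eqxx.
  - by apply/invariantP => a; rewrite !ffunE; apply: val_inj; apply: cs.
  - by apply/forallP => a; rewrite -lowf !ffunE rect_row_col.
case/andP => /andP[/invariantP rt /forallP rphi] /andP[/invariantP cs /forallP cphi].
have rc a : (p1 <= r a)%N ==> (c a < q2)%N by rewrite (eqP (rphi a)).
pose f := [ffun a => s2val (rect_exists (rc a))].
have fr a : rect_row (f a) = r a by rewrite ffunE; case: rect_exists.
have fc a : rect_col (f a) = c a by rewrite ffunE; case: rect_exists.
exists f; last by congr pair; apply/ffunP => a; rewrite ffunE ?fr ?fc.
rewrite unfold_in /= inE; apply/andP; split; last first.
  by apply/eqP/ffunP => a; rewrite ffunE fr (eqP (rphi a)).
apply/andP; split; apply/invariantP => a.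
  by have := congr1 val (rt a); rewrite -!fr.
by have := congr1 val (cs a); rewrite -!fc.
Qed.

Lemma normalized_character_two_rectangles : (k <= n)%N ->
  normalized_character k n la = Stanley_sum k p1%:R p2%:R q1%:R q2%:R.
Proof.
move=> le_kn; rewrite normalized_characterE // /signed_factorizations (exchange_big_dep predT) //=.
apply: eq_bigr => t _.
rewrite sumr_const -[LHS]mulr_natl.
have -> : #|[pred f : {ffun 'I_k -> 'I_n} | invariant (fun a => box_row la (f a)) t &&
    invariant (fun a => box_col la (f a)) (quotient_perm t)]| =
  #|[set f : {ffun 'I_k -> 'I_n} | invariant (fun a => box_row la (f a)) t &&
    invariant (fun a => box_col la (f a)) (quotient_perm t)]|.
  by apply: eq_card => f; rewrite !inE.
rewrite card_rect_functions natr_sum mulr_suml; apply: eq_bigr => phi _.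
rewrite natrM mulrC !natr_prod -mulrA; congr (_ * (_ * _)).
  by apply: eq_bigr => o _; case: ifP.
by apply: eq_bigr => o _; case: ifP.
Qed.

End TwoRectangles.

(** * Free cumulants of a union of two rectangles *)

Section CumulantSeries.

Variable A : comNzRingType.
Implicit Types (C : {poly A}) (R : nat -> A).

(** The factor u is invertible as a power series, so it can be cancelled modulo X^m. *)
Lemma coefXnM_unit (u f z : {poly A}) m : u`_0 = 1 -> u * f = 'X^m * z ->
  forall i, (i < m)%N -> f`_i = 0.
Proof.
move=> u0 e i; elim/ltn_ind: i => i IH lt_i.
have := congr1 (fun p : {poly A} => p`_i) e; rewrite coefXnM lt_i coefM big_ord_recl /= subn0.
rewrite u0 mul1r big1 ?addr0 // => j _.
by rewrite IH ?mulr0 //= /bump /=; move: (ltn_ord j); lia.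
Qed.

Section Defect.

Variables p1 p2 q1 q2 : A.

(* Numerator of G(C / X) / X - 1 for the diagram with p1 rows of length q1    *)
(* above p2 rows of length q2.                                                *)
Definition defect C : {poly A} :=
  (C - (q1 - p1)%:P * 'X) * (C - (q2 - p1 - p2)%:P * 'X) -
  (C - q1%:P * 'X) * (C - (q2 - p1)%:P * 'X) * (C - (- p1 - p2)%:P * 'X).

Definition cumulant_series R N : {poly A} := 1 + \sum_(1 <= i < N.+1) R i *: 'X^i.

(** The inverse expansion of G with denominators cleared. It makes sense over any commutative ring
    and passes through ring morphisms, which allows generic and nilpotent p1, p2. *)
Definition cumulant_sequence R : Prop :=
  forall N i, (i <= N)%N -> (defect (cumulant_series R N))`_i = 0.

Lemma cumulant_seriesS R N :
  cumulant_series R N.+1 = cumulant_series R N + R N.+1 *: 'X^(N.+1).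
Proof. by rewrite /cumulant_series big_nat_recr //= addrA. Qed.

Lemma coef0_cumulant_series R N : (cumulant_series R N)`_0 = 1.
Proof.
elim: N => [|N IH]; first by rewrite /cumulant_series big_geq // addr0 coef1.
by rewrite cumulant_seriesS coefD IH coefZ coefXn mulr0 addr0.
Qed.

(** The defect is a product of two factors minus a product of three, all with constant term 1, so
    adding r X^(N+1) to C changes its coefficient at N+1 by (2 - 3) r. This determines the cumulants
    one at a time. *)
Lemma coef_defectD C r N i : C`_0 = 1 -> (i <= N.+1)%N ->
  (defect (C + r *: 'X^(N.+1)))`_i = (defect C)`_i - (if i == N.+1 then r else 0).
Proof.
move=> C0 le_i; rewrite -mul_polyC; set Y := 'X^(N.+1).
set x1 := q1%:P; set x2 := (q2 - p1)%:P; set x3 := (- p1 - p2)%:P.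
set y1 := (q1 - p1)%:P; set y2 := (q2 - p1 - p2)%:P.
pose T : {poly A} := r%:P * Y.
pose H : {poly A} := (C + C + T - y1 * 'X - y2 * 'X) -
  ((C + T - x1 * 'X) * (C + T - x2 * 'X) + (C + T - x1 * 'X) * (C - x3 * 'X) +
   (C - x2 * 'X) * (C - x3 * 'X)).
have -> : defect (C + r%:P * Y) = defect C + r%:P * (Y * H).
  by rewrite /defect -/x1 -/x2 -/x3 -/y1 -/y2 /H /T; ring.
have H0 : H`_0 = -1.
  have T0 : T`_0 = 0 by rewrite /T coefCM coefXn mulr0.
  clearbody T; rewrite /H !(coefD, coefN, coefB, coef0M) !coefX !mulr0 T0 C0.
  by ring.
rewrite coefD coefCM coefXnM; congr (_ + _).
case: (ltngtP i N.+1) le_i => [_ _|//|-> _]; first by rewrite mulr0 oppr0.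
by rewrite subnn H0 mulrN1.
Qed.

Lemma coef_defect_seriesS R N i : (i <= N)%N ->
  (defect (cumulant_series R N.+1))`_i = (defect (cumulant_series R N))`_i.
Proof.
move=> le_i; rewrite cumulant_seriesS coef_defectD ?coef0_cumulant_series ?(leqW le_i) //.
by rewrite ltn_eqF ?subr0.
Qed.

Lemma cumulant_sequence_ge R n0 :
  (forall N i, (n0 <= N)%N -> (i <= N)%N -> (defect (cumulant_series R N))`_i = 0) ->
  cumulant_sequence R.
Proof.
move=> HR N i le_i; have := HR (N + n0)%N i (leq_addl _ _) (leq_trans le_i (leq_addr _ _)).
elim: n0 {HR} => [|m IH]; first by rewrite addn0.
by rewrite addnS coef_defect_seriesS ?(leq_trans le_i) ?leq_addr.
Qed.

Lemma cumulant_sequence_unique R R' : cumulant_sequence R -> cumulant_sequence R' ->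
  forall i, (0 < i)%N -> R i = R' i.
Proof.
move=> HR HR'; have coefE S : cumulant_sequence S ->
    forall N, S N.+1 = (defect (cumulant_series S N))`_N.+1.
  move=> HS N; have := HS N.+1 N.+1 (leqnn _).
  rewrite cumulant_seriesS coef_defectD ?coef0_cumulant_series // eqxx.
  by move/eqP; rewrite subr_eq0 => /eqP.
have CE N : cumulant_series R N = cumulant_series R' N.
  elim: N => [|N IH]; first by rewrite /cumulant_series !big_geq.
  by rewrite !cumulant_seriesS (coefE _ HR) (coefE _ HR') IH.
by case=> // i _; rewrite (coefE _ HR) (coefE _ HR') CE.
Qed.

Lemma cumulant_sequence_exists : {R | cumulant_sequence R}.
Proof.
pose fix C N : {poly A} := if N is M.+1 then
  C M + (defect (C M))`_N *: 'X^N else 1.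
pose R N := if N is M.+1 then (defect (C M))`_N else 0.
have CE N : cumulant_series R N = C N.
  by elim: N => [|N IH]; rewrite ?cumulant_seriesS ?IH // /cumulant_series big_geq ?addr0.
exists R; elim=> [|N IH] i.
  rewrite leqn0 => /eqP ->; rewrite CE /defect coefB !coef0M !coefB !coefMX coef1 /=.
  by rewrite !subr0 !mulr1 subrr.
rewrite leq_eqVlt => /orP[/eqP ->|]; last by rewrite ltnS => le; rewrite coef_defect_seriesS ?IH.
by rewrite cumulant_seriesS coef_defectD ?coef0_cumulant_series // eqxx CE subrr.
Qed.

End Defect.

End CumulantSeries.

Lemma rmorph_cumulant_sequence (A B : comNzRingType) (g : {rmorphism A -> B})
    (p1 p2 q1 q2 : A) (R : nat -> A) : cumulant_sequence p1 p2 q1 q2 R ->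
  cumulant_sequence (g p1) (g p2) (g q1) (g q2) (g \o R).
Proof.
move=> HR N i le_i; have SE : cumulant_series (g \o R) N = map_poly g (cumulant_series R N).
  rewrite /cumulant_series rmorphD rmorph1 rmorph_sum; congr (_ + _).
  by apply: eq_bigr => j _ /=; rewrite linearZ /= map_polyXn.
have -> : defect (g p1) (g p2) (g q1) (g q2) (cumulant_series (g \o R) N) =
    map_poly g (defect p1 p2 q1 q2 (cumulant_series R N)).
  rewrite SE /defect !(rmorphB, rmorphM) /= !map_polyX !map_polyC /=.
  by rewrite !(rmorphB, rmorphN).
by rewrite coef_map /= HR ?rmorph0.
Qed.

(** * Free cumulants modulo p1^2 and p2^2 *)

Section FirstOrder.

Variables (D : comNzRingType) (p1 p2 q1 q2 : D).
Hypotheses (p1_sq : p1 * p1 = 0) (p2_sq : p2 * p2 = 0).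

(** The complete homogeneous symmetric polynomial of degree m-1 in x and y, and 0 for m = 0. *)
Definition complete_sum (A : comNzRingType) (x y : A) m : A :=
  \sum_(i < m) x ^+ (m.-1 - i) * y ^+ i.

Lemma complete_sumS (A : comNzRingType) (x y : A) m :
  complete_sum x y m.+1 = x * complete_sum x y m + y ^+ m.
Proof.
rewrite /complete_sum big_ord_recr /= subnn expr0 mul1r; congr (_ + _).
rewrite mulr_sumr; apply: eq_bigr => i _; rewrite mulrA -exprS.
by congr (_ ^+ _ * _); have := ltn_ord i; lia.
Qed.

Definition first_order_cumulant (i : nat) : D :=
  if i is j.+2 then p1 * q1 ^+ j.+1 + p2 * q2 ^+ j.+1
    - j.+1%:R * (p1 * p2 * q2 * complete_sum q1 q2 j) else 0.

Let a : {poly D} := 1 - q1%:P * 'X.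
Let b : {poly D} := 1 - q2%:P * 'X.

(** The series q X^2 / (1 - q X), truncated with an explicit remainder so that the computation stays
    within polynomials; [complete_sum_trunc] does the same for q2 X^3 / ((1 - q1 X)(1 - q2 X)). *)
Lemma geometric_trunc (q : D) L :
  (1 - q%:P * 'X) * (\sum_(j < L.+1) q ^+ j.+1 *: 'X^(j.+2)) =
  q%:P * 'X^2 - 'X^(L.+3) * (q ^+ L.+2)%:P.
Proof.
elim: L => [|L IH].
  rewrite big_ord_recl big_ord0 addr0 -mul_polyC !rmorphXn /= expr1; ring.
rewrite big_ord_recr /= mulrDr IH -mul_polyC !exprS !polyCM !rmorphXn /=; ring.
Qed.

Lemma complete_sum_trunc L :
  a * b * (\sum_(j < L.+1) (q2 * complete_sum q1 q2 j) *: 'X^(j.+2)) =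
  q2%:P * 'X^3 - 'X^(L.+3) *
    (q2%:P * (complete_sum q1 q2 L.+1)%:P - q1%:P * q2%:P * q2%:P * (complete_sum q1 q2 L)%:P * 'X).
Proof.
elim: L => [|L IH].
  rewrite big_ord_recl big_ord0 addr0 complete_sumS {1 2 3}/complete_sum big_ord0.
  rewrite mulr0 scale0r mulr0 mulr0 add0r expr0 polyC0; ring.
rewrite big_ord_recr /= mulrDr IH -mul_polyC (complete_sumS _ _ L.+1) (complete_sumS _ _ L).
rewrite /a /b !exprS !(polyCM, polyCD) !rmorphXn /=; ring.
Qed.

Lemma first_order_expansion (A : comNzRingType) (X P1 P2 Q1 Q2 U1 U2 W : A) (a' := 1 - Q1 * X) (b' := 1 - Q2 * X)
   (C := 1 + (P1 * U1 + P2 * U2 + P1 * P2 * W)) :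
  P1 * P1 = 0 -> P2 * P2 = 0 ->
  (C - (Q1 - P1) * X) * (C - (Q2 - P1 - P2) * X) -
  (C - Q1 * X) * (C - (Q2 - P1) * X) * (C - (- P1 - P2) * X) =
  P1 * (b' * (Q1 * X ^+ 2 - a' * U1)) + P2 * (a' * (Q2 * X ^+ 2 - b' * U2)) +
  P1 * P2 * (X * U1 + X * U2 + X ^+ 2 - a' * b' * W
     - b' * (2%:R * (U1 * U2) + X * U1 + X * U2)
     - a' * (2%:R * (U1 * U2) + X * U1 + 2%:R * (X * U2) + X ^+ 2)).
Proof.
move=> h1 h2; rewrite /C /a' /b'; ring: h1 h2.
Qed.
(** The candidate series is 1 + p1 U1 + p2 U2 + p1 p2 W with rational U1, U2, W. Modulo truncation
    errors, the choice of U1 and U2 cancels the terms in p1 and p2 of the defect, and W cancels the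
    term in p1 p2, called [E]. *)
Lemma first_order_cumulantP :
  cumulant_sequence p1 p2 q1 q2 first_order_cumulant.
Proof.
apply: (@cumulant_sequence_ge _ _ _ _ _ _ 2) => N i; case: N => [|[|L]] // _ le_i.
pose U1 : {poly D} := \sum_(j < L.+1) q1 ^+ j.+1 *: 'X^(j.+2).
pose U2 : {poly D} := \sum_(j < L.+1) q2 ^+ j.+1 *: 'X^(j.+2).
pose H : {poly D} := \sum_(j < L.+1) (q2 * complete_sum q1 q2 j) *: 'X^(j.+2).
(* On X^(j+2) this operator is 1 - (j+2) = -(j+1), the factor in the cumulants. *)
pose W := H - 'X * H^`().
have -> : cumulant_series first_order_cumulant L.+2 =
    1 + (p1%:P * U1 + p2%:P * U2 + p1%:P * p2%:P * W).
  rewrite /cumulant_series; congr (1 + _).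
  rewrite big_nat_recl // scale0r add0r big_add1 /= big_mkord.
  rewrite /W /H linear_sum /U1 /U2 !mulr_sumr -sumrB !mulr_sumr -!big_split /=.
  apply: eq_bigr => j _.
  rewrite derivZ derivXn /= -!mul_polyC !exprS !(polyCM, polyCD, polyCN) !rmorphXn /=.
  by rewrite polyC_natr; ring.
have aU1 : a * U1 = q1%:P * 'X^2 - 'X^(L.+3) * (q1 ^+ L.+2)%:P by apply: geometric_trunc.
have bU2 : b * U2 = q2%:P * 'X^2 - 'X^(L.+3) * (q2 ^+ L.+2)%:P by apply: geometric_trunc.
have [h abH] : exists h, a * b * H = q2%:P * 'X^3 + 'X^(L.+3) * h.
  by rewrite complete_sum_trunc -mulrN; eexists.
have [h' abH'] : exists h', 'X * (a * b * H)^`() = 3%:R * (q2%:P * 'X^3) + 'X^(L.+3) * h'.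
  have XY n : 'X * ('X^n)^`() = n%:R * 'X^n :> {poly D}.
    case: n => [|n]; first by rewrite derivC mulr0 mul0r.
    by rewrite derivXn mulrnAr -exprS mulr_natl.
  exists (L.+3%:R * h + 'X * h^`()).
  have -> : (a * b * H)^`() = q2%:P * ('X^3)^`() + ('X^(L.+3))^`() * h + 'X^(L.+3) * h^`().
    by rewrite abH derivD !derivM derivC mul0r add0r addrA.
  have -> (u v w x y : {poly D}) : 'X * (u * v + w * x + y) = u * ('X * v) + ('X * w) * x + 'X * y.
    by ring.
  rewrite !XY; move: (L.+3%:R : {poly D}) ('X^(L.+3) : {poly D}) => m Y; ring.
pose E : {poly D} := 'X * U1 + 'X * U2 + 'X ^+ 2 - a * b * W
     - b * (2%:R * (U1 * U2) + 'X * U1 + 'X * U2)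
     - a * (2%:R * (U1 * U2) + 'X * U1 + 2%:R * ('X * U2) + 'X ^+ 2).
have -> : defect p1 p2 q1 q2 (1 + (p1%:P * U1 + p2%:P * U2 + p1%:P * p2%:P * W)) =
    p1%:P * ('X^(L.+3) * (b * (q1 ^+ L.+2)%:P)) + p2%:P * ('X^(L.+3) * (a * (q2 ^+ L.+2)%:P)) +
    (p1 * p2)%:P * E.
  rewrite /defect !polyCB !polyCN first_order_expansion -?polyCM ?p1_sq ?p2_sq //.
  rewrite -/a -/b aU1 bU2 /E; ring.
(* The product rule for (a b) H expresses W through a b H alone, whose truncation is known. *)
have aW : (a * b) ^+ 2 * W = a * b * (a * b * H) - a * b * ('X * (a * b * H)^`()) +
    'X * (a * b * H) * (- q1%:P * b - q2%:P * a).
  rewrite /W /a /b !(derivM, derivB, derivC, derivX); ring.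
have abE : a * b * E = 'X^(L.+3) * (
   ('X * b - b ^+ 2 * 'X - a * b * 'X) * - (q1 ^+ L.+2)%:P +
   ('X * a - a * b * 'X - 2%:R * a ^+ 2 * 'X) * - (q2 ^+ L.+2)%:P -
   2%:R * (a + b) * (q1%:P * 'X^2 * - (q2 ^+ L.+2)%:P + q2%:P * 'X^2 * - (q1 ^+ L.+2)%:P +
     'X^(L.+3) * (q1 ^+ L.+2)%:P * (q2 ^+ L.+2)%:P)
   - a * b * h + a * b * h' - 'X * (- q1%:P * b - q2%:P * a) * h).
  have -> : a * b * E = a * b * 'X^2 - a ^+ 2 * b * 'X^2 +
      ('X * b - b ^+ 2 * 'X - a * b * 'X) * (a * U1) +
      ('X * a - a * b * 'X - 2%:R * a ^+ 2 * 'X) * (b * U2)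
      - 2%:R * (a + b) * ((a * U1) * (b * U2)) - (a * b) ^+ 2 * W.
    rewrite /E; ring.
  rewrite aW abH' abH aU1 bU2 /a /b; ring.
have ab0 : (a * b)`_0 = 1.
  by rewrite coef0M !coefB !coefCM !coefX coef1 !mulr0 !subr0 mulr1.
have Ei := coefXnM_unit ab0 abE; rewrite !coefD !coefCM !coefXnM ltnS le_i Ei ?ltnS //.
by rewrite !mulr0 !addr0.
Qed.

End FirstOrder.

(** * The transition measure of two rectangles *)

Lemma Cauchy_transform_at_quotient (F : fieldType) (C X x1 x2 x3 y1 y2 : F) :
  X != 0 -> C - x1 * X != 0 -> C - x2 * X != 0 -> C - x3 * X != 0 ->
  (C / X - y1) * (C / X - y2) / ((C / X - x1) * ((C / X - x2) * (C / X - x3))) - X =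
  X * ((C - y1 * X) * (C - y2 * X) - (C - x1 * X) * (C - x2 * X) * (C - x3 * X)) /
  ((C - x1 * X) * (C - x2 * X) * (C - x3 * X)).
Proof.
move=> X0 n1 n2 n3; have n (x : F) : C - x * X != 0 -> C / X - x != 0.
  by apply: contraNneq => /eqP; rewrite subr_eq0 => /eqP <-; rewrite divfK ?subrr.
by field; rewrite X0 n1 n2 n3 /=.
Qed.

Section TwoRectanglesContents.

Variables p1 p2 q1 q2 : nat.
Hypotheses (p1_gt0 : (0 < p1)%N) (p2_gt0 : (0 < p2)%N) (q2_gt0 : (0 < q2)%N) (lt_q : (q2 < q1)%N).

Local Notation la := (two_rectangles p1 p2 q1 q2).

Lemma two_rectangles_partition : is_partition (p1 * q1 + p2 * q2) la.
Proof.
rewrite /is_partition sumn_two_rectangles eqxx andbT; apply/andP; split; last first.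
  by rewrite mem_cat !mem_nseq negb_or !negb_and; apply/andP; split; apply/orP; right; lia.
apply/(sortedP 0%N) => i; rewrite size_two_rectangles => lt.
rewrite !nth_two_rectangles; move: lt; rewrite /geq /=.
by do !case: ifP => ?; lia.
Qed.

Lemma addable_two_rectangles : addable_contents la =
  [:: q1%:R; q2%:R - p1%:R; - p1%:R - p2%:R].
Proof.
rewrite /addable_contents size_two_rectangles.
have -> : [seq a <- iota 0 (p1 + p2).+1 | addable_row la a] = [:: 0%N; p1; (p1 + p2)%N].
  apply: (irr_sorted_eq ltn_trans ltnn).
  - by apply: sorted_filter (iota_ltn_sorted _ _); apply: ltn_trans.
  - by rewrite /= p1_gt0 -{1}[p1]addn0 ltn_add2l p2_gt0.
  move=> [|a]; rewrite mem_filter mem_iota !inE //= !nth_two_rectangles.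
  by do !case: ifP => ?; lia.
rewrite /= !nth_two_rectangles p1_gt0 !ltnn.
have -> : (p1 + p2 < p1)%N = false by lia.
have -> : (p1 < p1 + p2)%N by lia.
by rewrite subr0 sub0r natrD opprD.
Qed.

Lemma removable_two_rectangles : removable_contents la =
  [:: q1%:R - p1%:R; q2%:R - p1%:R - p2%:R].
Proof.
rewrite /removable_contents size_two_rectangles.
have -> : [seq a <- iota 0 (p1 + p2) | removable_row la a] = [:: p1.-1; (p1 + p2).-1].
  apply: (irr_sorted_eq ltn_trans ltnn).
  - by apply: sorted_filter (iota_ltn_sorted _ _); apply: ltn_trans.
  - by rewrite /=; lia.
  move=> a; rewrite mem_filter mem_iota !inE /removable_row !nth_two_rectangles.
  by do !case: ifP => ?; lia.
have natr_pred m : (0 < m)%N -> m.-1%:R = m%:R - 1 :> rat.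
  by case: m => // m _; rewrite -natr1 addrK.
rewrite /= !nth_two_rectangles; have -> : (p1.-1 < p1)%N by lia.
have -> : ((p1 + p2).-1 < p1)%N = false by lia.
have -> : ((p1 + p2).-1 < p1 + p2)%N by lia.
by rewrite !natr_pred ?natrD ?addn_gt0 ?p1_gt0 //; [congr [:: _; _]; ring | lia].
Qed.

(** Evaluate G at C / X and clear denominators: they are nonzero at X = 0, so divisibility by a
    power of X passes to the defect. *)
Lemma inverse_expansion_cumulant (R : nat -> rat) : inverse_expansion la R ->
  cumulant_sequence p1%:R p2%:R q1%:R q2%:R R.
Proof.
move=> HR N i le_i; have [p [q [q0 e]]] := HR N.
set C := cumulant_series R N.
have C0 : C.[0] = 1 by rewrite horner_coef0 coef0_cumulant_series.
set x1 : {poly rat} := q1%:R%:P; set x2 : {poly rat} := (q2%:R - p1%:R)%:P.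
set x3 : {poly rat} := (- p1%:R - p2%:R)%:P.
set y1 : {poly rat} := (q1%:R - p1%:R)%:P; set y2 : {poly rat} := (q2%:R - p1%:R - p2%:R)%:P.
pose P := (C - x1 * 'X) * (C - x2 * 'X) * (C - x3 * 'X).
have P0 : P.[0] = 1.
  rewrite /P; clearbody C; rewrite !(hornerM, hornerD, hornerN) !hornerX !mulr0 !subr0.
  by rewrite C0 !mulr1.
have Fneq0 (f : {poly rat}) : f.[0] != 0 -> tofrac f != 0.
  by rewrite tofrac_eq0; apply: contraNneq => ->; rewrite horner0.
have X0 : tofrac ('X : {poly rat}) != 0 by rewrite tofrac_eq0 polyX_eq0.
have argE : truncated_inverse R N = tofrac C / tofrac 'X.
  rewrite /truncated_inverse /C /cumulant_series rmorphD rmorph1 mulrDl div1r; congr (_ + _).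
  rewrite rmorph_sum mulr_suml; apply: eq_big_nat => -[|j] // _.
  by rewrite exprSr scalerAl rmorphM mulfK.
have e1 : 'X * defect p1%:R p2%:R q1%:R q2%:R C * q = 'X^(N.+2) * p * P.
  have Pn0 := Fneq0 P; rewrite P0 oner_neq0 in Pn0.
  apply/eqP; rewrite -tofrac_eq (tofracM _ q) (tofracM _ P).
  rewrite -(eqr_div _ _ (Pn0 isT) (Fneq0 _ q0)) -e /Cauchy_transform.
  rewrite addable_two_rectangles removable_two_rectangles !big_cons !big_nil !mulr1 argE.
  have := Pn0 isT; rewrite /defect /P -/x1 -/x2 -/x3 -/y1 -/y2 !(rmorphM, rmorphB) /=.
  rewrite !mulf_eq0 !negb_or -!andbA => /and3P[n1 n2 n3].
  by rewrite (Cauchy_transform_at_quotient _ _ X0 n1 n2 n3) eqxx.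
have dv : 'X^(N.+1) %| defect p1%:R p2%:R q1%:R q2%:R C.
  have e2 : defect p1%:R p2%:R q1%:R q2%:R C * q = 'X^(N.+1) * p * P.
    by apply: (mulfI (negbT (polyX_eq0 _))); rewrite mulrA e1 exprS -!mulrA.
  have /Gauss_dvdpl <- : coprimep 'X^(N.+1) q.
    by rewrite coprimep_expl // -['X]subr0 -polyC0 coprimep_sym coprimep_XsubC.
  by rewrite e2 -mulrA dvdp_mulr.
by have /dvdpP[r ->] := dv; rewrite coefMXn ltnS le_i.
Qed.

Lemma free_cumulant_two_rectangles :
  cumulant_sequence p1%:R p2%:R q1%:R q2%:R (free_cumulant la).
Proof. by apply: inverse_expansion_cumulant; rewrite /free_cumulant; case: inverse_expansion_exists. Qed.

End TwoRectanglesContents.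

(** * Low-degree coefficients of Kerov's polynomial *)

Section KerovEvaluation.

Variable k : nat.
Implicit Types (K L : {mpoly int[k]}).

Lemma meval_map_intr (A : comNzRingType) (v : 'I_k -> A) K :
  (map_mpoly intr K).@[v] = mmap intr v K.
Proof.
rewrite [in LHS](mpolyE K) (raddf_sum (map_mpoly intr)) (raddf_sum (meval v)).
rewrite /mmap; apply: eq_bigr => m _.
by rewrite /= map_mpolyZ mevalZ map_mpolyX mevalX.
Qed.

Lemma rmorph_mmap_intr (A B : comNzRingType) (g : {rmorphism A -> B}) (v : 'I_k -> A) K :
  g (mmap intr v K) = mmap intr (g \o v) K.
Proof.
rewrite /mmap rmorph_sum; apply: eq_bigr => m _; rewrite rmorphM rmorph_int /mmap1 rmorph_prod.
by congr (_ * _); apply: eq_bigr => i _; rewrite rmorphXn.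
Qed.

Lemma eq_mmap_intr (A : comNzRingType) (v w : 'I_k -> A) K :
  v =1 w -> mmap intr v K = mmap intr w K.
Proof.
move=> e; rewrite /mmap; apply: eq_bigr => m _.
by rewrite (mmap1_eq _ e).
Qed.

Lemma mcoeff_mderiv0 K i : (K^`M(i))@_0%MM = K@_U_(i).
Proof. by rewrite mcoeff_deriv mnm0E add0m mulr1n. Qed.

(** The factor 2 on the diagonal is the source of the half in part (2). *)
Lemma mcoeff_mderiv20 K i j :
  (K^`M(i)^`M(j))@_0%MM = K@_(U_(j) + U_(i)) *+ (j == i).+1.
Proof. by rewrite mcoeff_mderiv0 mcoeff_deriv mnm1E. Qed.

Section Taylor.

Variables (D : comNzRingType) (p1 p2 : D) (al be ga : 'I_k -> D).
Hypotheses (p1_sq : p1 * p1 = 0) (p2_sq : p2 * p2 = 0).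

Definition linear_part (v : 'I_k -> D) K : D :=
  \sum_(i < k) ((K^`M(i))@_0%MM)%:~R * v i.

(** No factor 1/2: the Taylor term of degree 2 at p1 v + p2 w contains the mixed product p1 p2
    twice. *)
Definition quadratic_part (v w : 'I_k -> D) K : D :=
  \sum_(i < k) \sum_(j < k) ((K^`M(i)^`M(j))@_0%MM)%:~R * (v i * w j).

(** The Taylor expansion at 0. As p1^2 = p2^2 = 0, it is additive and multiplicative in K, hence is
    the evaluation as soon as it agrees with it on constants and variables. *)
Let value K : D := (K@_0%MM)%:~R + p1 * linear_part al K + p2 * linear_part be K +
  p1 * p2 * (linear_part ga K + quadratic_part al be K).

Let linear_partM v K L : linear_part v (K * L) =
  linear_part v K * (L@_0%MM)%:~R + (K@_0%MM)%:~R * linear_part v L.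
Proof.
rewrite /linear_part mulr_suml mulr_sumr -big_split; apply: eq_bigr => i _ /=.
by rewrite mderivM mcoeffD !(rmorphM (mcoeff 0%MM)) !(rmorphD, rmorphM) /=; ring.
Qed.

Let quadratic_partM v w K L : quadratic_part v w (K * L) =
  quadratic_part v w K * (L@_0%MM)%:~R + linear_part v K * linear_part w L +
  linear_part w K * linear_part v L + (K@_0%MM)%:~R * quadratic_part v w L.
Proof.
rewrite [linear_part w K * _]mulrC /quadratic_part /linear_part !big_distrlr /=.
rewrite mulr_suml mulr_sumr -!big_split; apply: eq_bigr => i _ /=.
rewrite mulr_suml mulr_sumr -!big_split; apply: eq_bigr => j _ /=.
rewrite mderivM mderivD !mderivM !mcoeffD !(rmorphM (mcoeff 0%MM)) !(rmorphD, rmorphM) /=.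
ring.
Qed.

Let valueM K L : value (K * L) = value K * value L.
Proof.
rewrite /value !linear_partM quadratic_partM (rmorphM (mcoeff 0%MM)) rmorphM /=.
ring: p1_sq p2_sq.
Qed.

Let valueD K L : value (K + L) = value K + value L.
Proof.
have linD v : linear_part v (K + L) = linear_part v K + linear_part v L.
  rewrite /linear_part -big_split; apply: eq_bigr => i _ /=.
  by rewrite mderivD mcoeffD rmorphD mulrDl.
have quadD v w : quadratic_part v w (K + L) = quadratic_part v w K + quadratic_part v w L.
  rewrite /quadratic_part -big_split; apply: eq_bigr => i _ /=.
  rewrite -big_split; apply: eq_bigr => j _ /=.
  by rewrite !mderivD mcoeffD rmorphD mulrDl.
by rewrite /value !linD quadD mcoeffD rmorphD /=; ring.
Qed.

Let valueC c : value c%:MP = c%:~R.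
Proof.
have lin0 v : linear_part v c%:MP = 0.
  by rewrite /linear_part big1 // => i _; rewrite mderivC mcoeff0 mul0r.
rewrite /value !lin0 mcoeffC eqxx mulr1 /quadratic_part big1 => [|i _]; first by ring.
by rewrite big1 // => j _; rewrite mderivC mderiv0 mcoeff0 mul0r.
Qed.

Let valueX i : value 'X_i = p1 * al i + p2 * be i + p1 * p2 * ga i.
Proof.
have linX v : linear_part v 'X_i = v i.
  rewrite /linear_part (bigD1 i) //= mcoeff_mderiv0 mcoeffXU eqxx mul1r big1 ?addr0 // => j nj.
  by rewrite mcoeff_mderiv0 mcoeffXU eq_sym (negPf nj) mul0r.
have quadX v w : quadratic_part v w 'X_i = 0.
  rewrite /quadratic_part big1 // => j _; rewrite big1 // => l _.
  rewrite mcoeff_mderiv20 mcoeffX; case: eqP => [/(congr1 (@mdeg _))|]; last by rewrite mul0rn mul0r.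
  by rewrite mdegD !mdeg1.
rewrite /value !linX quadX mcoeffX; case: eqP => [/(congr1 (@mdeg _))|_]; last by rewrite /= addr0 add0r.
by rewrite mdeg1 mdeg0.
Qed.

Let value1 : value 1 = 1.
Proof. by rewrite -[1 in LHS]mpolyC1 valueC. Qed.

Lemma mmap_first_order K :
  mmap intr (fun i => p1 * al i + p2 * be i + p1 * p2 * ga i) K =
  (K@_0%MM)%:~R + p1 * linear_part al K + p2 * linear_part be K +
  p1 * p2 * (linear_part ga K + quadratic_part al be K).
Proof.
rewrite -/(value K); have valueXn L n : value (L ^+ n) = value L ^+ n.
  by elim: n => [|n IH]; rewrite ?expr0 // !exprS valueM IH.
rewrite [K in RHS]mpolyE /mmap; move: (msupp K) => s.
elim: s => [|m s IH]; first by rewrite !big_nil -[0 in RHS]mpolyC0 valueC.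
rewrite !big_cons valueD IH -mul_mpolyC valueM valueC; congr (_ * _ + _).
rewrite mpolyXE_id (big_morph _ valueM value1) /mmap1; apply: eq_bigr => i _.
by rewrite valueXn valueX.
Qed.

End Taylor.
End KerovEvaluation.

Definition meeting_orbits k (s : 'S_k) (phi : 'I_k -> bool) : nat :=
  #|[set o in porbits s | [exists a in o, phi a]]|.

Lemma orbit_weightE (A : comNzRingType) k (s : 'S_k) (phi : 'I_k -> bool) (x y : A) :
  orbit_weight s phi x y =
  x ^+ (#|porbits s| - meeting_orbits s phi) * y ^+ meeting_orbits s phi.
Proof.
rewrite /orbit_weight (bigID (fun o : {set 'I_k} => [exists a in o, phi a])) /= mulrC.
congr (_ * _).
  rewrite (eq_bigr (fun=> x)) => [|o /andP[_ /negPf ->] //].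
  rewrite prodr_const; congr (_ ^+ _).
  rewrite /meeting_orbits -[in RHS](cardsID [set o : {set 'I_k} | [exists a in o, phi a]] (porbits s)).
  have -> : porbits s :&: [set o : {set 'I_k} | [exists a in o, phi a]] = [set o in porbits s | [exists a in o, phi a]].
    by apply/setP => o; rewrite !inE.
  by rewrite addKn; apply: eq_card => o; rewrite !inE andbC.
rewrite (eq_bigr (fun=> y)) => [|o /andP[_ ->] //].
by rewrite prodr_const; congr (_ ^+ _); apply: eq_card => o; rewrite !inE.
Qed.

Lemma meeting_orbits_le k (s : 'S_k) phi : (meeting_orbits s phi <= #|porbits s|)%N.
Proof. by apply: subset_leq_card; apply/subsetP => o; rewrite inE => /andP[]. Qed.

Lemma poly_eq0_natr (A : idomainType) (f : {poly A}) n0 :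
  (forall m n, m%:R = n%:R :> A -> m = n) ->
  (forall n, (n0 <= n)%N -> f.[n%:R] = 0) -> f = 0.
Proof.
move=> natI f0; apply/eqP/contraT => nz.
have := max_poly_roots nz (rs := [seq n%:R | n <- iota n0 (size f)]).
rewrite size_map size_iota ltnn; apply.
  by apply/allP => _ /mapP[n nI ->]; rewrite rootE f0 ?eqxx //; move: nI; rewrite mem_iota => /andP[].
by rewrite map_inj_uniq ?iota_uniq // => m n; apply: natI.
Qed.

Lemma poly_natr_inj (A : nzRingType) : (forall m n, m%:R = n%:R :> A -> m = n) ->
  forall m n, m%:R = n%:R :> {poly A} -> m = n.
Proof. by move=> H m n; rewrite -!polyC_natr => /polyC_inj/H. Qed.

Lemma in_qpolyXn_coef (A : comNzRingType) (f : {poly A}) i :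
  in_qpoly 'X^2 f = 0 -> (i < 2)%N -> f`_i = 0.
Proof.
move=> /(congr1 val) /= e lt_i.
have mo := monic_mk_monic ('X^2 : {poly A}).
rewrite (Pdiv.RingMonic.rdivp_eq mo f) e addr0 mk_monic_Xn /=.
by rewrite coefMXn lt_i.
Qed.

(** * Kerov's identity with indeterminate p1, p2, q1, q2 *)

Section KerovIdentity.

Variables (k : nat) (K : {mpoly int[k]}).
Hypotheses (k_gt0 : (0 < k)%N) (KK : is_Kerov_polynomial K).

Local Notation A := {poly {poly rat}}.
Local Notation B := {poly {poly A}}.
Local Notation q1 := ('X%:P : A).
Local Notation q2 := ('X : A).
Local Notation gp1 := ('X%:P : B).
Local Notation gp2 := ('X : B).
Local Notation gq1 := (q1%:P%:P : B).
Local Notation gq2 := (q2%:P%:P : B).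

Lemma Kerov_identity_nat (p1 p2 m1 m2 : nat) (R : nat -> rat) :
  (k <= p1)%N -> (0 < p2)%N -> (0 < m2)%N -> (m2 < m1)%N ->
  cumulant_sequence p1%:R p2%:R m1%:R m2%:R R ->
  Stanley_sum k p1%:R p2%:R m1%:R m2%:R = mmap intr (fun i => R i.+2) K :> rat.
Proof.
move=> le_k p2_gt0 m2_gt0 lt_m HR.
have p1_gt0 : (0 < p1)%N by apply: leq_trans le_k.
have m1_gt0 : (0 < m1)%N by apply: leq_trans lt_m.
have le_n : (k <= p1 * m1 + p2 * m2)%N.
  by rewrite (leq_trans le_k) // (leq_trans _ (leq_addr _ _)) // leq_pmulr.
have := KK (two_rectangles_partition p1_gt0 p2_gt0 m2_gt0 lt_m) le_n.
rewrite normalized_character_two_rectangles // ?(ltnW lt_m) // meval_map_intr.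
rewrite -!(ratr_nat algC) -rmorph_Stanley_sum => /fmorph_inj ->.
apply: eq_mmap_intr => i; apply: (cumulant_sequence_unique _ HR) => //.
exact: free_cumulant_two_rectangles.
Qed.

Lemma Kerov_identity_generic : exists2 R : nat -> B,
  cumulant_sequence gp1 gp2 gq1 gq2 R &
  Stanley_sum k gp1 gp2 gq1 gq2 = mmap intr (fun i => R i.+2) K.
Proof.
have [R HR] := cumulant_sequence_exists gp1 gp2 gq1 gq2; exists R => //.
apply/eqP; rewrite -subr_eq0; apply/eqP; set F := _ - _.
have nat0 : forall m n, m%:R = n%:R :> rat -> m = n.
  by move=> m n /eqP; rewrite eqr_nat => /eqP.
have nat1 := poly_natr_inj nat0; have nat2 := poly_natr_inj nat1; have nat3 := poly_natr_inj nat2.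
(* The variables are specialised in the order p2, p1, q2, q1. The bound p1 >= k makes the diagram
   large enough, and q1 comes last because q1 > q2 is required. *)
apply: (poly_eq0_natr (n0 := 1) nat3) => n4 n4_gt0.
apply: (poly_eq0_natr (n0 := k) nat2) => n3 n3_ge.
apply: (poly_eq0_natr (n0 := 1) nat1) => n2 n2_gt0.
apply: (poly_eq0_natr (n0 := n2.+1) nat0) => n1 n1_gt.
pose ev : {rmorphism B -> rat} := horner_eval (n1%:R : rat) \o
  (horner_eval (n2%:R : {poly rat}) \o (horner_eval (n3%:R : A) \o horner_eval (n4%:R : {poly A}))).
rewrite -[LHS]/(ev F) /F rmorphB rmorph_Stanley_sum rmorph_mmap_intr.
have natE (T : comNzRingType) (x : T) n : (n%:R : {poly T}).[x] = n%:R.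
  by rewrite -polyC_natr hornerC.
have evp1 : ev gp1 = n3%:R by rewrite /ev /= /horner_eval hornerC hornerX !natE.
have evp2 : ev gp2 = n4%:R by rewrite /ev /= /horner_eval hornerX !natE.
have evq1 : ev gq1 = n1%:R by rewrite /ev /= /horner_eval !hornerC hornerX.
have evq2 : ev gq2 = n2%:R by rewrite /ev /= /horner_eval !hornerC hornerX natE.
have := rmorph_cumulant_sequence ev HR; rewrite evp1 evp2 evq1 evq2 => evR.
by rewrite (Kerov_identity_nat n3_ge n4_gt0 n2_gt0 n1_gt evR) subrr.
Qed.

End KerovIdentity.

Lemma in_qpolyX2_eq0 (A : comNzRingType) : in_qpoly 'X^2 ('X^2 : {poly A}) = 0.
Proof.
apply: val_inj => /=; have mo := monic_mk_monic ('X^2 : {poly A}).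
by have := Pdiv.RingMonic.rmodpp mo; rewrite {1}mk_monic_Xn.
Qed.

Lemma rmorph_linear_part (A B : comNzRingType) (g : {rmorphism A -> B}) k
    (v : 'I_k -> A) (K : {mpoly int[k]}) :
  g (linear_part v K) = linear_part (g \o v) K.
Proof.
by rewrite rmorph_sum; apply: eq_bigr => i _; rewrite rmorphM rmorph_int.
Qed.

Lemma rmorph_quadratic_part (A B : comNzRingType) (g : {rmorphism A -> B}) k
    (v w : 'I_k -> A) (K : {mpoly int[k]}) :
  g (quadratic_part v w K) = quadratic_part (g \o v) (g \o w) K.
Proof.
rewrite rmorph_sum; apply: eq_bigr => i _; rewrite rmorph_sum; apply: eq_bigr => j _.
by rewrite !rmorphM rmorph_int.
Qed.

Lemma rmorph_complete_sum (A B : comNzRingType) (g : {rmorphism A -> B}) x y m :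
  g (complete_sum x y m) = complete_sum (g x) (g y) m.
Proof.
by rewrite rmorph_sum; apply: eq_bigr => i _; rewrite rmorphM !rmorphXn.
Qed.

(** * Extraction of the coefficients of p1 and p1 p2 *)

Section Truncation.

Variable A : comNzRingType.

Local Notation A1 := {poly %/ ('X^2 : {poly A})}.

(** Reduction of A[p1][p2] modulo p1^2 and p2^2; it loses none of the coefficients of degree at most
    1 in each variable. *)
Definition trunc2 : {rmorphism {poly {poly A}} -> {poly %/ ('X^2 : {poly A1})}} :=
  in_qpoly ('X^2 : {poly A1}) \o map_poly (in_qpoly ('X^2 : {poly A})).

Lemma trunc2_coef f i j : trunc2 f = 0 -> (i < 2)%N -> (j < 2)%N -> (f`_i)`_j = 0.
Proof.
move=> f0 lt_i lt_j; apply: in_qpolyXn_coef lt_j.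
by have := in_qpolyXn_coef f0 lt_i; rewrite coef_map.
Qed.

Lemma trunc2_inner : trunc2 'X%:P * trunc2 'X%:P = 0.
Proof.
rewrite -rmorphM -polyCM -expr2 /trunc2 /= map_polyC /= in_qpolyX2_eq0 polyC0.
exact: in_qpoly0.
Qed.

Lemma trunc2_outer : trunc2 'X * trunc2 'X = 0.
Proof. by rewrite -rmorphM -expr2 /trunc2 /= map_polyXn in_qpolyX2_eq0. Qed.

End Truncation.

Lemma bipoly_monomial (A : comNzRingType) (s m : A) a b :
  s%:P%:P * ('X%:P ^+ a * 'X ^+ b) * m%:P%:P = ('X^a * (s * m)%:P)%:P * 'X^b :> {poly {poly A}}.
Proof.
rewrite !polyCM polyC_exp; move: (s%:P%:P) (m%:P%:P) => u v.
by move: ('X%:P ^+ a) ('X ^+ b) => x y; rewrite [u * (x * y)]mulrCA !mulrA [_ * v * y]mulrAC.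
Qed.

Lemma bipoly_coef (A : comNzRingType) (a0 a1 a2 a3 : A)
    (f : {poly {poly A}} := a0%:P%:P + 'X%:P * a1%:P%:P + 'X * a2%:P%:P + 'X%:P * 'X * a3%:P%:P) :
  (f`_0)`_1 = a1 /\ (f`_1)`_1 = a3.
Proof.
have -> : f = (a0%:P + 'X * a1%:P)%:P + 'X * (a2%:P + 'X * a3%:P)%:P.
  by rewrite /f !polyCD !polyCM mulrDr -!addrA mulrCA !mulrA.
rewrite !coefD !coefC !coefXM !coefC /= !coefD !coefC !coefXM !coefC /= ?coef0.
by rewrite !addr0 !add0r.
Qed.

(** After the reduction g, the generic cumulants satisfy the same equations as
    [first_order_cumulant], so uniqueness identifies them and [mmap_first_order] applies. *)
Lemma mmap_cumulant_first_order (A B D : comNzRingType) (iota : {rmorphism A -> B})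
    (g : {rmorphism B -> D}) (p1 p2 : B) (q1 q2 : A) (R : nat -> B) k (K : {mpoly int[k]})
    (al := fun i : 'I_k => q1 ^+ i.+1) (be := fun i : 'I_k => q2 ^+ i.+1)
    (ga := fun i : 'I_k => - (i.+1%:R * (q2 * complete_sum q1 q2 i))) :
  cumulant_sequence p1 p2 (iota q1) (iota q2) R ->
  g p1 * g p1 = 0 -> g p2 * g p2 = 0 ->
  g (mmap intr (fun i : 'I_k => R i.+2) K) = g (iota (K@_0%MM)%:~R +
    p1 * iota (linear_part al K) + p2 * iota (linear_part be K) +
    p1 * p2 * iota (linear_part ga K + quadratic_part al be K)).
Proof.
move=> HR p1_sq p2_sq; pose h : {rmorphism A -> D} := g \o iota.
have hE x : g (iota x) = h x by [].
have gR : cumulant_sequence (g p1) (g p2) (h q1) (h q2) (g \o R).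
  exact: rmorph_cumulant_sequence.
have fo := first_order_cumulantP (h q1) (h q2) p1_sq p2_sq.
have gRE i : (g \o (fun i : 'I_k => R i.+2)) i =
    g p1 * (h \o al) i + g p2 * (h \o be) i + g p1 * g p2 * (h \o ga) i.
  transitivity (first_order_cumulant (g p1) (g p2) (h q1) (h q2) i.+2).
    exact: (cumulant_sequence_unique gR fo).
  rewrite [RHS]/= -!hE !(rmorphXn, rmorphN, rmorphM, rmorph_nat) !hE.
  by rewrite rmorph_complete_sum [LHS]/=; ring.
rewrite rmorph_mmap_intr (eq_mmap_intr _ gRE) mmap_first_order //.
rewrite !(rmorphD, rmorphM) !hE rmorph_int.
by rewrite !rmorph_linear_part rmorph_quadratic_part.
Qed.

Section KerovCoefficients.

Variables (k : nat) (K : {mpoly int[k]}).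
Hypotheses (k_gt0 : (0 < k)%N) (KK : is_Kerov_polynomial K).

Local Notation A := {poly {poly rat}}.
Local Notation B := {poly {poly A}}.
Local Notation q1 := ('X%:P : A).
Local Notation q2 := ('X : A).

(** The coefficient of p1^(c-N) p2^N in [Stanley_sum]: t has c cycles, N of them marked. *)
Definition factorization_sum (c N : nat) : A :=
  \sum_(t : 'S_k | #|porbits t| == c)
    \sum_(phi : {ffun 'I_k -> bool} | invariant phi t && (meeting_orbits t phi == N))
      (-1) ^+ quotient_perm t *
      (q1 ^+ (#|porbits (quotient_perm t)| - meeting_orbits (quotient_perm t) phi) *
       q2 ^+ meeting_orbits (quotient_perm t) phi).

Lemma coef_Stanley_sum c N : (N <= c)%N ->
  ((Stanley_sum k ('X%:P : B) 'X q1%:P%:P q2%:P%:P)`_N)`_(c - N) = factorization_sum c N.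
Proof.
move=> le_N; rewrite /Stanley_sum coef_sum coef_sum /factorization_sum [RHS]big_mkcond.
apply: eq_bigr => t _; rewrite coef_sum coef_sum.
have termE (phi : {ffun 'I_k -> bool}) :
  (((-1) ^+ quotient_perm t * orbit_weight t phi ('X%:P : B) 'X *
     orbit_weight (quotient_perm t) phi q1%:P%:P q2%:P%:P)`_N)`_(c - N) =
  if (#|porbits t| == c) && (meeting_orbits t phi == N) then (-1) ^+ quotient_perm t *
      (q1 ^+ (#|porbits (quotient_perm t)| - meeting_orbits (quotient_perm t) phi) *
       q2 ^+ meeting_orbits (quotient_perm t) phi) else 0.
  rewrite !orbit_weightE.
  set a := (_ - meeting_orbits t phi)%N; set b := meeting_orbits t phi.
  set x := (_ - _)%N; set y := meeting_orbits _ phi; set s := quotient_perm t.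
  have -> : (-1) ^+ s * (('X%:P : B) ^+ a * 'X ^+ b) *
      (q1%:P%:P ^+ x * q2%:P%:P ^+ y) =
      ('X^a * ((-1) ^+ s * (q1 ^+ x * q2 ^+ y))%:P)%:P * 'X^b :> B.
    have -> : q1%:P%:P ^+ x * q2%:P%:P ^+ y = (q1 ^+ x * q2 ^+ y)%:P%:P :> B.
      by rewrite !polyCM !polyC_exp.
    have -> : (-1) ^+ s = ((-1) ^+ s)%:P%:P :> B by case: (odd_perm s); rewrite ?expr0 ?expr1 ?polyCN.
    exact: bipoly_monomial.
  rewrite coefCM coefXn mulr_natr; case: eqP => [eN|nb]; last first.
    by rewrite mulr0n coef0 ifN // negb_and; apply/orP; right; apply/eqP => e; case: nb.
  have le_bc : (b <= c)%N by rewrite -eN.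
  rewrite eN mulr1n eqxx andbT coefMC coefXn.
  have -> : (c - b == a)%N = (#|porbits t| == c).
    have := meeting_orbits_le t phi; rewrite -/b => le_b.
    by rewrite /a -(eqn_add2r b) (subnK le_bc) (subnK le_b) eq_sym.
  by case: eqP => _; rewrite ?mul1r ?mul0r.
rewrite (eq_bigr _ (fun phi _ => termE phi)).
case: eqP => _ /=; last by rewrite big1.
by rewrite -big_mkcondr.
Qed.

Lemma Kerov_coefficients :
  factorization_sum 1 0 = linear_part (fun i => q1 ^+ i.+1) K /\
  factorization_sum 2 1 =
    linear_part (fun i => - (i.+1%:R * (q2 * complete_sum q1 q2 i))) K +
    quadratic_part (fun i => q1 ^+ i.+1) (fun i => q2 ^+ i.+1) K.
Proof.
have [R HR SE] := Kerov_identity_generic k_gt0 KK.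
pose iota : {rmorphism A -> B} := polyC \o polyC.
have e := mmap_cumulant_first_order (iota := iota) K HR (trunc2_inner A) (trunc2_outer A).
rewrite -SE in e; move: e.
set a0 : A := (K@_0%MM)%:~R; set a1 := linear_part _ K; set a2 := linear_part _ K.
set a3 := linear_part _ K + quadratic_part _ _ K => e.
set f : B := iota a0 + _ + _ + _ in e.
have coefE i j : (i < 2)%N -> (j < 2)%N ->
    ((Stanley_sum k ('X%:P : B) 'X q1%:P%:P q2%:P%:P)`_i)`_j = (f`_i)`_j.
  move=> lt_i lt_j; apply/eqP; rewrite -subr_eq0 -!coefB; apply/eqP.
  by apply: trunc2_coef => //; rewrite rmorphB e subrr.
have [f01 f11] := bipoly_coef a0 a1 a2 a3.
split.
  by rewrite -(coef_Stanley_sum (leq0n 1)) coefE.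
by rewrite -(coef_Stanley_sum (leqnSn 1)) coefE.
Qed.
End KerovCoefficients.

(** * Counting factorizations of the long cycle *)

Section LongCycle.

Variable k : nat.
Hypothesis k_gt0 : (0 < k)%N.

Lemma invariant_long_cycle (T : eqType) (h : 'I_k -> T) :
  invariant h (long_cycle k k) -> forall a b, h a = h b.
Proof.
move=> /invariantP hs; pose a0 := Ordinal k_gt0.
suff h0 a : h a = h a0 by move=> a b; rewrite !h0.
case: a => i; elim: i => [|i IH] lt_i; first by congr h; apply: val_inj.
rewrite -(IH (ltnW lt_i)) -(hs (Ordinal (ltnW lt_i))); congr h; apply: val_inj.
rewrite permE /long_cycle_fun /= (ltnW lt_i) val_insubd minnn.
by rewrite ltn_mod k_gt0 modn_small.
Qed.

Lemma card_porbits_long_cycle : #|porbits (long_cycle k k)| = 1%N.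
Proof.
set s := long_cycle k k.
have inv : invariant (porbit s) s.
  by apply/invariantP => a; have := porbit_perm s 1 a; rewrite expg1.
apply/eqP/cards1P; exists (porbit s (Ordinal k_gt0)); apply/setP => o; rewrite inE.
apply/imsetP/eqP => [[a _ ->]|->]; first exact: invariant_long_cycle.
by exists (Ordinal k_gt0).
Qed.

(** The parity of a permutation is that of k minus its number of cycles, and sigma has one cycle.
    All terms of one [factorization_sum] thus carry the same sign. *)
Lemma odd_quotient_perm (t : 'S_k) : odd_perm (quotient_perm t) = ~~ odd #|porbits t|.
Proof.
rewrite /quotient_perm odd_permM odd_permV /odd_perm card_porbits_long_cycle /=.
by case: (odd #|'I_k|); case: (odd _).
Qed.

End LongCycle.

Section MeetingOrbits.

Variable k : nat.
Implicit Types (s t : 'S_k) (phi : {ffun 'I_k -> bool}).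

Definition negf phi : {ffun 'I_k -> bool} := [ffun a => ~~ phi a].

Lemma negfK : involutive negf.
Proof. by move=> phi; apply/ffunP => a; rewrite !ffunE negbK. Qed.

Lemma invariant_negf t phi : invariant (negf phi) t = invariant phi t.
Proof. by apply: eq_forallb => a; rewrite !ffunE (inj_eq negb_inj). Qed.

(** Every cycle meets [phi] or its complement; those meeting both are counted twice. *)
Lemma meeting_orbitsUI s phi :
  (meeting_orbits s phi + meeting_orbits s (negf phi) = #|porbits s| +
   #|[set o in porbits s | [exists a in o, phi a] && [exists a in o, negf phi a]]|)%N.
Proof.
rewrite /meeting_orbits -cardsUI; congr (_ + _)%N; apply: eq_card => o; rewrite !inE; last first.
  by rewrite andbACA andbb.
rewrite -andb_orr; case: imsetP => //= -[a _ ->].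
apply/orP; case pa: (phi a); [left|right]; apply/exists_inP; exists a; rewrite ?porbit_id //.
by rewrite ffunE pa.
Qed.

Lemma invariant_meeting_orbits t phi : invariant phi t ->
  (meeting_orbits t phi + meeting_orbits t (negf phi) = #|porbits t|)%N.
Proof.
move=> inv; rewrite meeting_orbitsUI -[RHS]addn0; congr (_ + _)%N; apply/eqP.
rewrite cards_eq0; apply/eqP/setP => o; rewrite !inE; apply/negP => /and3P[].
move=> /imsetP[c _ ->] /exists_inP[a ac pa] /exists_inP[b bc].
by rewrite ffunE (invariant_porbit inv bc) -(invariant_porbit inv ac) pa.
Qed.

Hypothesis k_gt0 : (0 < k)%N.

(* Otherwise phi is invariant under t and under t^-1 sigma, hence under the   *)
(* transitive permutation sigma.                                              *)
Lemma meeting_orbits_connected t phi : #|porbits t| = 2%N -> invariant phi t ->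
  meeting_orbits t phi = 1%N ->
  (#|porbits (quotient_perm t)| <
   meeting_orbits (quotient_perm t) phi + meeting_orbits (quotient_perm t) (negf phi))%N.
Proof.
move=> ct inv N1; rewrite meeting_orbitsUI -{1}[#|porbits _|]addn0 ltn_add2l card_gt0.
set s := quotient_perm t; apply/negP => /eqP none.
have invs : invariant phi s.
  apply/invariantP => a; apply/eqP/negPn/negP => ne.
  suff: porbit s a \in (set0 : {set {set 'I_k}}) by rewrite inE.
  rewrite -none inE imset_f //=.
  have sa : s a \in porbit s a by have := mem_porbit s 1 a; rewrite expg1.
  case pa: (phi a) ne => ne; apply/andP; split; apply/exists_inP.
  - by exists a; rewrite ?porbit_id.
  - by exists (s a); rewrite // ffunE; case: (phi (s a)) ne.
  - by exists (s a); rewrite //; case: (phi (s a)) ne.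
  by exists a; rewrite ?porbit_id // ffunE pa.
have inv_lc : invariant phi (long_cycle k k).
  apply/invariantP => a; have -> : long_cycle k k = (s * t)%g by rewrite mulgKV.
  by rewrite permM (invariantP _ _ inv) (invariantP _ _ invs).
have phic := invariant_long_cycle k_gt0 inv_lc.
have := N1; have := ct; rewrite /meeting_orbits.
case p0: (phi (Ordinal k_gt0)) => {}ct.
  have -> : [set o in porbits t | [exists a in o, phi a]] = porbits t; last by rewrite ct.
  apply/setP => o; rewrite inE; case: imsetP => //= -[a _ ->].
  by apply/exists_inP; exists a; rewrite ?porbit_id // (phic a (Ordinal k_gt0)).
have -> : [set o in porbits t | [exists a in o, phi a]] = set0; last by rewrite cards0.
apply/setP => o; rewrite !inE; apply/negP => /andP[_ /exists_inP[a _]].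
by rewrite (phic a (Ordinal k_gt0)) p0.
Qed.

End MeetingOrbits.

(** * Labelled permutations with two cycles as bicolourings *)

Section LabelledPairs.

Variable k : nat.
Hypothesis k_gt0 : (0 < k)%N.
Local Notation pair := ('S_k * {ffun 'I_k -> bool})%type.

(* The pairs (tau, phi) of the theorem: true marks the points of the cycle    *)
(* labelled 2.                                                                *)
Definition bicoloured : {set pair} :=
  [set x : pair | [&& #|porbits x.1| == 2%N, invariant x.2 x.1 & meeting_orbits x.1 x.2 == 1%N]].

Definition meets1 (x : pair) := meeting_orbits (quotient_perm x.1) (negf x.2).
Definition meets2 (x : pair) := meeting_orbits (quotient_perm x.1) x.2.
Definition cycles_number (x : pair) := #|porbits (quotient_perm x.1)|.

Lemma bicolouredP (x : pair) :
  reflect [/\ #|porbits x.1| = 2%N, invariant x.2 x.1 & meeting_orbits x.1 x.2 = 1%N]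
          (x \in bicoloured).
Proof. by rewrite inE; apply: (iffP and3P) => -[c i m]; split=> //; apply/eqP. Qed.

Lemma bicoloured_connected x : x \in bicoloured ->
  (cycles_number x < meets1 x + meets2 x)%N.
Proof. by case/bicolouredP => *; rewrite addnC; apply: meeting_orbits_connected. Qed.

Definition swap_colours (x : pair) : pair := (x.1, negf x.2).

Lemma swap_coloursK : involutive swap_colours.
Proof. by case=> t phi; rewrite /swap_colours /= negfK. Qed.

Lemma swap_bicoloured x : (swap_colours x \in bicoloured) = (x \in bicoloured).
Proof.
suff H y : y \in bicoloured -> swap_colours y \in bicoloured.
  by apply/idP/idP => [/H|/H //]; rewrite swap_coloursK.
case: y => t phi /bicolouredP /= [ct inv N1]; apply/bicolouredP; rewrite /= invariant_negf.
by split=> //; have := invariant_meeting_orbits inv; rewrite ct N1 add1n => -[].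
Qed.

Lemma card_swap_colours (P Q : pred pair) : (forall x, P (swap_colours x) = Q x) ->
  #|[set x in bicoloured | P x]| = #|[set x in bicoloured | Q x]|.
Proof.
move=> PQ; rewrite -(card_imset [set x in bicoloured | P x] (inv_inj swap_coloursK)).
apply: eq_card => x; apply/imsetP/idP => [[y yP ->]|].
  move: yP; rewrite inE => /andP[yb yp].
  by rewrite inE swap_bicoloured yb -PQ swap_coloursK.
rewrite inE => /andP[xb xQ]; exists (swap_colours x); last by rewrite swap_coloursK.
by rewrite inE swap_bicoloured xb PQ.
Qed.

Definition colouring (psi : {ffun 'I_2 -> {set 'I_k}}) : {ffun 'I_k -> bool} :=
  [ffun a => a \in psi ord_max].

(** A labelling of two cycles amounts to the indicator function of the cycle labelled 2, the other
    cycle being its complement. *)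
Lemma card_labelled_pairs j l : #|labelled_pairs k j l| =
  #|[set x in bicoloured | [&& cycles_number x == (j + l - 2)%N,
       (j <= meets1 x)%N & (l <= meets2 x)%N]]|.
Proof.
have meetE (s : 'S_k) (V : {set 'I_k}) (phi : {ffun 'I_k -> bool}) :
    (forall a, phi a = (a \in V)) -> #|cycles_meeting s V| = meeting_orbits s phi.
  move=> e; apply: eq_card => o; rewrite !inE; congr (_ && _).
  apply/set0Pn/exists_inP => [[a]|[a ao pa]].
    by rewrite inE => /andP[ao aV]; exists a; rewrite ?e.
  by exists a; rewrite inE ao -e.
have I2 (i : 'I_2) : i = ord0 \/ i = ord_max.
  by case: i => -[|[|//]] lt; [left|right]; apply: val_inj.
pose G (y : 'S_k * {ffun 'I_2 -> {set 'I_k}}) : pair := (y.1, colouring y.2).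
have psi0 (y : 'S_k * {ffun 'I_2 -> {set 'I_k}}) : y \in labelled_pairs k j l ->
    forall a, (a \in y.2 ord0) = ~~ colouring y.2 a.
  case: y => t psi; rewrite inE /= => /and5P[_ /injectiveP pinj /eqP pim _ _] a.
  rewrite ffunE.
  have pP i : psi i \in porbits t by rewrite -pim imset_f.
  have psiE i : a \in psi i -> psi i = porbit t a.
    by have /imsetP[b _ ->] := pP i; rewrite -eq_porbit_mem => /eqP.
  have : porbit t a \in porbits t by apply: imset_f.
  rewrite -pim => /imsetP[i _ ei].
  have [e|e] := I2 i; rewrite e in ei.
    rewrite -ei porbit_id; apply/esym; apply/negP => /psiE; rewrite ei => /pinj.
    by move/(congr1 val).
  rewrite -ei porbit_id /=; apply/negP => /psiE; rewrite ei => /pinj.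
  by move/(congr1 val).
have Ginj : {in labelled_pairs k j l &, injective G}.
  move=> y y' yL y'L [e1 e2]; case: y y' yL y'L e1 e2 => t psi [t' psi'] yL y'L /= e1 e2.
  congr (_, _); first by [].
  apply/ffunP => i; apply/setP => a; have [->|->] := I2 i.
    by rewrite (psi0 _ yL) (psi0 _ y'L) /= e2.
  by have /ffunP/(_ a) := e2; rewrite !ffunE.
rewrite -(card_in_imset Ginj); apply: eq_card => -[t phi].
apply/imsetP/idP => [[y yL ->]|].
  rewrite /G; have p0 := psi0 _ yL; case: y yL p0 => t' psi /=.
  rewrite inE /= => /and5P[/eqP ct /injectiveP pinj /eqP pim cm /andP[m1 m2]] p0.
  have pP i : psi i \in porbits t' by rewrite -pim imset_f.
  have inv : invariant (colouring psi) t'.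
    apply/invariantP => a; rewrite !ffunE; have /imsetP[b _ ->] := pP ord_max.
    by rewrite -!eq_porbit_mem; have := porbit_perm t' 1 a; rewrite expg1 => ->.
  rewrite inE; apply/andP; split.
    apply/bicolouredP; split=> //=; rewrite -(meetE _ (psi ord_max)) => [|a]; last by rewrite ffunE.
    apply/eqP/cards1P; exists (psi ord_max); apply/setP => o; rewrite !inE.
    apply/andP/eqP => [[oP /set0Pn[a]]|->].
      rewrite inE => /andP[ao ap]; move: oP ao (pP ord_max) ap.
      move=> /imsetP[b _ ->] + /imsetP[b' _ ->].
      by rewrite -!eq_porbit_mem => /eqP <- /eqP <-.
    split=> //; have /imsetP[b _ e] := pP ord_max; apply/set0Pn; exists b.
    by rewrite setIid e porbit_id.
  rewrite /cycles_number cm /meets1 /meets2 /=.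
  rewrite -(meetE _ (psi ord_max) (colouring psi)) => [|a]; last by rewrite ffunE.
  rewrite -(meetE _ (psi ord0) (negf (colouring psi))) => [|a]; first by rewrite m1 m2.
  by rewrite p0 ffunE.
rewrite inE => /andP[/bicolouredP /= [ct inv N1]] /and3P[cm m1 m2].
pose psi : {ffun 'I_2 -> {set 'I_k}} :=
  [ffun i => if i == ord0 then [set a | ~~ phi a] else [set a | phi a]].
have colE : colouring psi = phi by apply/ffunP => a; rewrite !ffunE /= inE.
exists (t, psi); last by rewrite /G /= colE.
have blockP (f : {ffun 'I_k -> bool}) : invariant f t -> meeting_orbits t f = 1%N ->
    [set a | f a] \in porbits t /\ exists a, f a.
  move=> finv /eqP/cards1P[o oE].
  have : o \in [set o] by rewrite inE.
  rewrite -oE inE => /andP[oP /exists_inP[a ao fa]]; split; last by exists a.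
  suff -> : [set a | f a] = o by [].
  apply/setP => b; rewrite inE; apply/idP/idP => [fb|bo].
    have : porbit t b \in [set o].
      by rewrite -oE inE imset_f //=; apply/exists_inP; exists b; rewrite ?porbit_id.
    by rewrite inE => /eqP <-; rewrite porbit_id.
  have /imsetP[c _ e] := oP; rewrite e in ao bo.
  by rewrite (invariant_porbit finv bo) -(invariant_porbit finv ao).
have [P2 [a2 pa2]] := blockP _ inv N1.
have N0 : meeting_orbits t (negf phi) = 1%N.
  by have := invariant_meeting_orbits inv; rewrite ct N1 add1n => -[].
have invn : invariant (negf phi) t by rewrite invariant_negf.
have [P1 [a1 pa1]] := blockP _ invn N0.
have psi0E : psi ord0 = [set a | negf phi a] by rewrite ffunE; apply/setP => a; rewrite !inE ffunE.
have psi1E : psi ord_max = [set a | phi a] by rewrite ffunE.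
have ne : psi ord0 != psi ord_max.
  apply/eqP => /setP/(_ a2); rewrite psi0E psi1E !inE ffunE pa2; by [].
rewrite inE ct eqxx /=; apply/and5P; split.
- apply/injectiveP => i i'; have [->|->] := I2 i; have [->|->] := I2 i' => //.
    by move/eqP: ne.
  by move=> /esym; move/eqP: ne.
- rewrite eqEcard; apply/andP; split.
    apply/subsetP => _ /imsetP[i _ ->]; have [->|->] := I2 i; rewrite ?psi0E ?psi1E //.
  rewrite ct; have -> : psi @: [set: 'I_2] = [set psi ord0; psi ord_max].
    apply/setP => o; rewrite !inE; apply/imsetP/orP => [[i _ ->]|].
      by have [->|->] := I2 i; [left|right].
    by case=> /eqP ->; eexists.
  by rewrite cards2 ne.
- by [].
- by rewrite (meetE _ _ (negf phi)) // => a; rewrite psi0E inE.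
by rewrite (meetE _ _ phi) // => a; rewrite psi1E inE.
Qed.

End LabelledPairs.

(** * Coefficients of q1^a q2^b *)

Section BivariateCoefficients.

Local Notation A := {poly {poly rat}}.
Local Notation q1 := ('X%:P : A).
Local Notation q2 := ('X : A).

Variables a b : nat.

Definition bicoef (f : A) : rat := (f`_b)`_a.

Lemma bicoef_sum I (r : seq I) (P : pred I) (F : I -> A) :
  bicoef (\sum_(i <- r | P i) F i) = \sum_(i <- r | P i) bicoef (F i).
Proof. by rewrite /bicoef !coef_sum. Qed.

Lemma bicoefD f g : bicoef (f + g) = bicoef f + bicoef g.
Proof. by rewrite /bicoef !coefD. Qed.

Lemma bicoefMz (z : int) f : bicoef (z%:~R * f) = z%:~R * bicoef f.
Proof. by rewrite /bicoef -(rmorph_int (@polyC _)) coefCM -(rmorph_int (@polyC _)) coefCM. Qed.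

Lemma bicoef_monomial m n : bicoef (q1 ^+ m * q2 ^+ n) = ((m == a) && (n == b))%:R.
Proof.
rewrite /bicoef -polyC_exp coefCM coefXn mulr_natr eq_sym andbC.
by case: eqP => _; rewrite ?mulr0n ?coef0 // mulr1n coefXn eq_sym.
Qed.

(** Each monomial q1^a q2^b with b > 0 and a + b = i occurs exactly once, so for b > 0 only a + b
    matters. *)
Lemma bicoef_complete_sum i :
  bicoef (q2 * complete_sum q1 q2 i) = ((0 < b)%N && (a + b == i)%N)%:R.
Proof.
rewrite /complete_sum mulr_sumr bicoef_sum.
rewrite (eq_bigr (fun u : 'I_i => ((i.-1 - u == a)%N && (u.+1 == b))%:R)) => [|u _]; last first.
  by rewrite mulrCA -exprS bicoef_monomial.
case: b => [|b'] /=; first by rewrite big1 // => u _; rewrite andbF.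
have [lt|le] := ltnP b' i; last first.
  rewrite big1 => [|u _]; first by rewrite (_ : (a + b'.+1 == i) = false)%N //; lia.
  by rewrite eqSS (ltn_eqF (leq_trans (ltn_ord u) le)) andbF.
rewrite (bigD1 (Ordinal lt)) //= eqxx andbT big1 ?addr0 => [|u nu].
  by congr (_%:R); congr nat_of_bool; lia.
by rewrite eqSS (_ : (u == b' :> nat) = false) ?andbF //; apply: negbTE.
Qed.

End BivariateCoefficients.

(** * From coefficient identities to counts of permutations *)

Section FinalCounts.

Variables (k : nat) (K : {mpoly int[k]}).
Hypotheses (k_gt0 : (0 < k)%N) (KK : is_Kerov_polynomial K).

Definition bicoloured_count m n : nat :=
  #|[set x in bicoloured k | (cycles_number x == m) && (meets2 x == n)]|.

(** With no marked cycle the only colouring is the constant one, and the sign is + for a full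
    cycle. *)
Lemma bicoef_factorization_sum10 a :
  bicoef a 0 (factorization_sum k 1 0) = #|full_cycles k a.+1|%:R.
Proof.
rewrite /factorization_sum bicoef_sum.
pose phi0 : {ffun 'I_k -> bool} := [ffun=> false].
have meet0 (s : 'S_k) : meeting_orbits s phi0 = 0%N.
  apply/eqP; rewrite cards_eq0; apply/eqP/setP => o; rewrite !inE.
  by apply/negP => /andP[_ /exists_inP[c _]]; rewrite ffunE.
rewrite (eq_bigr (fun t => (#|porbits (quotient_perm t)| == a)%:R)) => [|t /eqP ct]; last first.
  rewrite (big_pred1 phi0) => [|phi /=].
    rewrite meet0 subn0 odd_quotient_perm // ct mul1r bicoef_monomial eqxx andbT //.
  apply/andP/eqP => [[inv /eqP]|->]; last first.
    by rewrite meet0; split=> //; apply/invariantP => c; rewrite !ffunE.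
  move/eqP; rewrite cards_eq0 => /eqP none; apply/ffunP => c; rewrite ffunE.
  apply/negP => pc; suff: porbit t c \in (set0 : {set {set 'I_k}}) by rewrite inE.
  by rewrite -none inE imset_f //=; apply/exists_inP; exists c; rewrite ?porbit_id.
rewrite -natr_sum -big_mkcondr /= sum1_card; congr (_%:R).
by apply: eq_card => t; rewrite !inE.
Qed.

Lemma bicoef_factorization_sum21 a b :
  bicoef a b (factorization_sum k 2 1) = - (bicoloured_count (a + b)%N b)%:R.
Proof.
rewrite /factorization_sum pair_big_dep /= bicoef_sum.
rewrite (eq_bigr (fun x => - ((cycles_number x == a + b)%N && (meets2 x == b))%:R)).
  rewrite sumrN -natr_sum; congr (- _%:R).
  rewrite /bicoloured_count -sum1_card -big_mkcondr /=.
  by apply: eq_bigl => -[t phi]; rewrite !inE /= -!andbA.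
move=> -[t phi] /= /andP[/eqP ct _]; rewrite odd_quotient_perm // ct /=.
rewrite -[-1]/(-1%:~R) -mulrNz bicoefMz bicoef_monomial mulN1r; congr (- _%:R).
rewrite /cycles_number /meets2 /=; have := meeting_orbits_le (quotient_perm t) phi.
by move: #|_| (meeting_orbits _ _) => c n le_n; congr nat_of_bool; lia.
Qed.

Lemma Kerov_linear_coefficient (i : 'I_k) : K@_U_(i) = #|full_cycles k i.+2|%:Z.
Proof.
have [e _] := Kerov_coefficients k_gt0 KK.
have := congr1 (bicoef i.+1 0) e; rewrite bicoef_factorization_sum10 bicoef_sum.
rewrite (bigD1 i) //= big1 => [|j nj]; rewrite bicoefMz -[X in bicoef _ _ X]mulr1 -(expr0 'X) bicoef_monomial.
  rewrite eqxx mulr1 addr0 mcoeff_mderiv0 => /esym e1.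
  by apply/eqP; rewrite -(eqr_int rat) e1.
by rewrite eqSS (negPf (_ : j != i :> nat)) ?mulr0.
Qed.

(** The identity for p1 p2 is read at q2^(i+j+2) and at q1^(i+1) q2^(j+1). The linear terms of K
    contribute equally to both, the quadratic ones only to the latter. *)
Lemma Kerov_quadratic_coefficient (i j : 'I_k) :
  (bicoloured_count (i + j).+2 (i + j).+2)%:Z - (bicoloured_count (i + j).+2 j.+1)%:Z =
  K@_(U_(i) + U_(j)) *+ (i == j).+1.
Proof.
have [_ e] := Kerov_coefficients k_gt0 KK.
set X := linear_part _ K in e.
have XE a b : (0 < b)%N -> bicoef a b X = bicoef 0 (a + b)%N X.
  move=> b_gt0; rewrite /X !bicoef_sum; apply: eq_bigr => l _.
  rewrite !bicoefMz -!mulNr -[- l.+1%:R]/(- (l.+1%:Z)%:~R) -!mulrNz !bicoefMz.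
  by rewrite !bicoef_complete_sum b_gt0 addn_gt0 b_gt0 orbT add0n.
have QE a b : bicoef a b (quadratic_part (fun i : 'I_k => 'X%:P ^+ i.+1) (fun i => 'X ^+ i.+1) K) =
    \sum_(l < k) \sum_(r < k) ((K^`M(l)^`M(r))@_0%MM)%:~R * ((l.+1 == a) && (r.+1 == b))%:R.
  rewrite bicoef_sum; apply: eq_bigr => l _; rewrite bicoef_sum; apply: eq_bigr => r _.
  by rewrite bicoefMz bicoef_monomial.
have eij : (i.+1 + j.+1 = (i + j).+2)%N by rewrite addSn addnS.
have e0 := congr1 (bicoef 0 (i.+1 + j.+1)%N) e; have e1 := congr1 (bicoef i.+1 j.+1) e.
rewrite bicoef_factorization_sum21 bicoefD QE eij in e0.
rewrite bicoef_factorization_sum21 bicoefD QE XE // eij in e1.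
(* Every monomial of the quadratic part has a positive power of q1. *)
rewrite big1 ?addr0 in e0 => [|l _]; last by rewrite big1 // => r _; rewrite mulr0.
rewrite -e0 (bigD1 i) //= (bigD1 j) //= !eqxx mulr1 in e1.
rewrite big1 ?addr0 in e1 => [|r nr]; last first.
  by rewrite eqSS (negPf (_ : r != j :> nat)) ?andbF ?mulr0.
rewrite big1 ?addr0 in e1 => [|l nl]; last first.
  by rewrite big1 // => r _; rewrite eqSS (negPf (_ : l != i :> nat)) ?mulr0.
have -> : K@_(U_(i) + U_(j)) *+ (i == j).+1 = (K^`M(i)^`M(j))@_0%MM.
  by rewrite mcoeff_mderiv20 addmC eq_sym.
have e2 : (bicoloured_count (i + j).+2 (i + j).+2)%:R - (bicoloured_count (i + j).+2 j.+1)%:R =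
    ((K^`M(i)^`M(j))@_0%MM)%:~R :> rat.
  by rewrite e1 addrA subrr add0r.
by apply/eqP; rewrite -(eqr_int rat) rmorphB /= -e2.
Qed.

(** Exchanging i and j changes neither the coefficient of K nor the first count in
    [Kerov_quadratic_coefficient]. If i + j + 2 > k both sides are 0, as there are at most k
    cycles. *)
Lemma bicoloured_count_sym i j :
  bicoloured_count (i + j).+2 i.+1 = bicoloured_count (i + j).+2 j.+1.
Proof.
have zero m n : (k < m)%N -> bicoloured_count m n = 0%N.
  move=> lt_m; apply/eqP; rewrite cards_eq0; apply/eqP/setP => x; rewrite !inE.
  apply/negP => /and3P[_ /eqP e _]; move: lt_m; rewrite -e ltnNge /cycles_number.
  by rewrite -[X in (_ <= X)%N]card_ord leq_imset_card.
have [lt_m|le_m] := ltnP k (i + j).+2; first by rewrite !zero.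
have lt_i : (i < k)%N by lia.
have lt_j : (j < k)%N by lia.
have e1 := Kerov_quadratic_coefficient (Ordinal lt_i) (Ordinal lt_j).
have := Kerov_quadratic_coefficient (Ordinal lt_j) (Ordinal lt_i).
rewrite [(_ + Ordinal lt_i)%N]addnC addmC eq_sym -e1 => /addrI/oppr_inj/eqP.
by rewrite eqz_nat => /eqP ->.
Qed.

(** Otherwise the cycles meeting colour 1 alone would outnumber all cycles, by
    [bicoloured_connected]. *)
Lemma bicoloured_count0 m : bicoloured_count m 0 = 0%N.
Proof.
apply/eqP; rewrite cards_eq0; apply/eqP/setP => x; rewrite [RHS]inE inE.
apply/negP => /and3P[xb /eqP cm /eqP m2]; have := bicoloured_connected k_gt0 xb.
by rewrite m2 addn0 ltnNge meeting_orbits_le.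
Qed.

Lemma card_meets2_lt m n : #|[set x in bicoloured k | (cycles_number x == m) && (meets2 x < n)%N]| =
  (\sum_(0 <= b < n) bicoloured_count m b)%N.
Proof.
elim: n => [|n IH].
  by rewrite big_geq //; apply/eqP; rewrite cards_eq0; apply/eqP/setP => x; rewrite !inE ltn0 !andbF.
rewrite big_nat_recr //= -IH -cardsUI [X in (_ + X)%N](_ : _ = 0%N) ?addn0.
  apply: eq_card => x; rewrite in_setU !inE -!andb_orr ltnS leq_eqVlt orbC; by [].
apply/eqP; rewrite cards_eq0; apply/eqP/setP => x; rewrite in_setI [RHS]inE.
apply/negP => /andP[]; rewrite !inE => /and3P[_ _ lt] /and3P[_ _ /eqP e].
by rewrite e ltnn in lt.
Qed.

Lemma card_labelled_pairsE j l :
  (#|labelled_pairs k j.+2 l.+2| + bicoloured_count (j + l).+2 l.+1)%N =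
  bicoloured_count (j + l).+2 (j + l).+2.
Proof.
rewrite card_labelled_pairs // (_ : (j.+2 + l.+2 - 2 = (j + l).+2)%N); last by lia.
set m := (j + l).+2.
have cardE (P : pred ('S_k * {ffun 'I_k -> bool})) :
    #|[set x in bicoloured k | (cycles_number x == m) && P x]| =
    (\sum_(x in bicoloured k | cycles_number x == m) P x)%N.
  rewrite -sum1_card [RHS]big_mkcond /= big_mkcond /=; apply: eq_bigr => x _.
  by rewrite inE; case: (x \in _); case: (_ == m); case: (P x).
(* Failing both inequalities would give [meets1] + [meets2] <= (j+1) + (l+1) = m, against
   connectedness; so the two excluded sets are disjoint. *)
have split3 : (#|[set x in bicoloured k | (cycles_number x == m) && (meets2 x < m.+1)%N]| =
    #|[set x in bicoloured k | [&& cycles_number x == m, j.+2 <= meets1 x & l.+2 <= meets2 x]%N]| +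
    #|[set x in bicoloured k | (cycles_number x == m) && (meets2 x < l.+2)%N]| +
    #|[set x in bicoloured k | (cycles_number x == m) && (meets1 x < j.+2)%N]|)%N.
  rewrite !cardE -!big_split /=; apply: eq_bigr => x /andP[xb /eqP cm].
  have := bicoloured_connected k_gt0 xb; rewrite cm /m => lt_m.
  have : (meets2 x <= (j + l).+2)%N by rewrite -/m -cm meeting_orbits_le.
  by move: lt_m; move: (meets1 x) (meets2 x) => u v; lia.
have swapE : #|[set x in bicoloured k | (cycles_number x == m) && (meets1 x < j.+2)%N]| =
    #|[set x in bicoloured k | (cycles_number x == m) && (meets2 x < j.+2)%N]|.
  by apply: card_swap_colours => -[t phi]; rewrite /meets1 /= negfK.
move: split3; rewrite swapE.
rewrite !card_meets2_lt => /esym e.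
(* The term b = 0 vanishes, and the symmetry b -> m - b sends 1..j+1 onto l+1..m-1. This range
   overlaps 0..l+1 in l+1 only, whence the correction term. *)
have sumj : (\sum_(0 <= b < j.+2) bicoloured_count m b =
    \sum_(l.+1 <= b < m) bicoloured_count m b)%N.
  rewrite big_ltn // bicoloured_count0 add0n big_nat_rev /=.
  rewrite (big_addn 1 m l) (_ : (m - l = j.+2)%N); last by lia.
  apply: eq_big_nat => b /andP[b_gt0 lt_b].
  rewrite (_ : (1 + j.+2 - b.+1 = (j - b.-1).+1)%N); last by lia.
  rewrite (_ : m = (j - b.-1 + (b + l).-1).+2); last by lia.
  by rewrite bicoloured_count_sym; congr bicoloured_count; lia.
have suml : (\sum_(0 <= b < m.+1) bicoloured_count m b = \sum_(0 <= b < l.+2) bicoloured_count m b +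
   \sum_(l.+2 <= b < m) bicoloured_count m b + bicoloured_count m m)%N.
  by rewrite big_nat_recr //= (big_cat_nat (n := l.+2)) //=; lia.
have sumj' : (\sum_(l.+1 <= b < m) bicoloured_count m b = bicoloured_count m l.+1 +
   \sum_(l.+2 <= b < m) bicoloured_count m b)%N.
  by rewrite big_ltn //; lia.
by move: e; rewrite sumj suml sumj'; lia.
Qed.
End FinalCounts.

Lemma Kerov_coef1 k (K : {mpoly int[k]}) (i : 'I_k) : Kerov_coef K [:: i.+2] = K@_U_(i).
Proof.
rewrite /Kerov_coef /= !ltnS ltn_ord; congr (K@_ _); apply/mnmP => l.
by rewrite mnmE mnm1E /= addn0 !eqSS.
Qed.

Lemma Kerov_coef2 k (K : {mpoly int[k]}) (i j : 'I_k) :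
  Kerov_coef K [:: i.+2; j.+2] = K@_(U_(i) + U_(j)).
Proof.
rewrite /Kerov_coef /= !ltnS !ltn_ord; congr (K@_ _); apply/mnmP => l.
by rewrite mnmE mnmDE !mnm1E /= addn0 !eqSS.
Qed.

Lemma card_porbits_le k (s : 'S_k) : (#|porbits s| <= k)%N.
Proof. by rewrite -[leqRHS]card_ord leq_imset_card. Qed.

Lemma card_full_cycles_out k d : (0 < k)%N -> ~~ (2 <= d <= k.+1)%N -> #|full_cycles k d| = 0%N.
Proof.
move=> k_gt0 nd; apply/eqP; rewrite cards_eq0; apply/eqP/setP => t; rewrite !inE.
apply/negP => /andP[_ /eqP e]; have := card_porbits_le (quotient_perm t).
have : (0 < #|porbits (quotient_perm t)|)%N.
  by rewrite card_gt0; apply/set0Pn; exists (porbit (quotient_perm t) (Ordinal k_gt0)); apply: imset_f.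
by rewrite e; lia.
Qed.

(** If j = 1, then l of the l-1 cycles would have to meet a set, and likewise for l = 1; if j or l
    exceeds k+1, then j + l - 2 exceeds k. *)
Lemma card_labelled_pairs_out k j l : (0 < j)%N -> (0 < l)%N ->
  ~~ ((2 <= j <= k.+1) && (2 <= l <= k.+1))%N -> #|labelled_pairs k j l| = 0%N.
Proof.
move=> j_gt0 l_gt0 out; apply/eqP; rewrite cards_eq0; apply/eqP/setP => -[t psi]; rewrite !inE.
apply/negP => /and5P[_ _ _ /eqP cs /andP[mj ml]].
have meet_le V : (#|cycles_meeting (quotient_perm t) V| <= #|porbits (quotient_perm t)|)%N.
  by apply: subset_leq_card; apply/subsetP => o; rewrite inE => /andP[].
have := card_porbits_le (quotient_perm t).
have := leq_trans mj (meet_le _); have := leq_trans ml (meet_le _); rewrite cs.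
by move: out; lia.
Qed.

Theorem theorem1p4p4 (k : nat) (k_gt0 : (0 < k)%N)
    (K : {mpoly int[k]}) (KK : is_Kerov_polynomial K) :
  (forall d : nat, (0 < d)%N ->
     Kerov_coef K [:: d] = #|full_cycles k d|%:Z) /\
  (forall j l : nat, (0 < j)%N -> (0 < l)%N ->
     (j != l -> Kerov_coef K [:: j; l] = #|labelled_pairs k j l|%:Z) /\
     (j = l ->
        (Kerov_coef K [:: j; l])%:Q = #|labelled_pairs k j l|%:R / 2%:R)).
Proof.
split=> [d d_gt0|j l j_gt0 l_gt0].
  have [d_in|d_out] := boolP (2 <= d <= k.+1)%N; last first.
    by rewrite card_full_cycles_out // /Kerov_coef /= andbT (negPf d_out).
  case: d d_in {d_gt0} => [|[|d]] // d_in; have lt_d : (d < k)%N by [].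
  by rewrite (Kerov_coef1 K (Ordinal lt_d)) Kerov_linear_coefficient.
have [jl_in|jl_out] := boolP ((2 <= j <= k.+1) && (2 <= l <= k.+1))%N; last first.
  rewrite card_labelled_pairs_out // /Kerov_coef /= andbT (negPf jl_out).
  by split=> // _; rewrite mul0r.
case/andP: jl_in => j_in l_in.
case: j j_in {j_gt0} => [|[|j]] // j_in; case: l l_in {l_gt0} => [|[|l]] // l_in.
have lt_j : (j < k)%N by []; have lt_l : (l < k)%N by [].
have e := Kerov_quadratic_coefficient k_gt0 KK (Ordinal lt_j) (Ordinal lt_l).
rewrite /= -(card_labelled_pairsE k_gt0 KK) PoszD addrK -(Kerov_coef2 K) /= in e.
split=> [njl|[ejl]].
  by rewrite e -[Ordinal _ == _]/(j.+2 == l.+2) (negPf njl) mulr1n.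
have -> : #|labelled_pairs k j.+2 l.+2|%:R = #|labelled_pairs k j.+2 l.+2|%:Z%:~R :> rat by [].
(* On the diagonal the second derivative is twice the coefficient, so the count is halved. *)
rewrite e -[Ordinal _ == _]/(j.+2 == l.+2) ejl eqxx rmorphMn /= -mulr_natr mulfK //.
Qed.
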